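(* For each dimension $d$, consider the Metropolis–Hastings algorithm with $$\text{target } N(A^{-1}b,A^{-1}),\qquad \text{proposal } y=Gx+M^{-1}\beta+(\mathcal{A}^{-1}-G\mathcal{A}^{-1}G^T)^{1/2}\xi,\quad \xi\sim N(0,I),$$ where $\mathcal{A}=M-N$, $G=M^{-1}N$. Suppose that $M$ and $N$ are functions of $A$, and that the Markov chain is in equilibrium, i.e. $x\sim N(A^{-1}b,A^{-1})$. Let $\lambda_i^2$, $\tilde\lambda_i^2$ and $G_i$ ($\lambda_i,\tilde\lambda_i>0$) be the eigenvalues of $A$, $\mathcal{A}$ and $G$ respectively, for the common eigenvectors $q_i$, $i=1,\dots,d$. Define $$\tilde g_i:=1-G_i,\quad g_i:=1-G_i^2,\quad m_i:=q_i^TA^{-1}b,\quad \tilde m_i:=q_i^T\mathcal{A}^{-1}\beta,$$ $$r_i:=\frac{\lambda_i^2-\tilde\lambda_i^2}{\lambda_i^2},\qquad \tilde r_i:=\frac{\lambda_i^2-\tilde\lambda_i^2}{\tilde\lambda_i^2},\qquad \hat r_i:=m_i-\tilde m_i,$$ and $$T_{0i}:=\hat r_i^2\lambda_i^2(\tfrac12 r_ig_i-\tilde g_i),\qquad T_{1i}:=\hat r_i\lambda_i(r_ig_i-\tilde g_i),$$ $$T_{2i}:=\hat r_i\lambda_i g_i^{1/2}(1+\tilde r_i)^{1/2}(1-r_iG_i),\qquad T_{3i}:=\tfrac12 r_ig_i,$$ $$T_{4i}:=-\tfrac12 r_ig_i(1+\tilde r_i),\qquad T_{5i}:=-r_iG_ig_i^{1/2}(1+\tilde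 r_i)^{1/2}.$$ If there exists $\delta>0$ such that $$\lim_{d\to\infty}\frac{\sum_{i=1}^d|T_{ji}|^{2+\delta}}{\big(\sum_{i=1}^d|T_{ji}|^2\big)^{1+\delta/2}}=0\qquad\text{for } j=1,2,3,4,5,$$ then $$Z:=\log\Big(\frac{\pi(y)q(y,x)}{\pi(x)q(x,y)}\Big)\xrightarrow{\mathcal D}N(\mu,\sigma^2)\qquad\text{as } d\to\infty,$$ where $\mu=\lim_{d\to\infty}\sum_{i=1}^d\mu_i$ and $\sigma^2=\lim_{d\to\infty}\sum_{i=1}^d\sigma_i^2$ (these limits being assumed to exist and be finite, with $\sigma>0$) and $$\mu_i=T_{0i}+T_{3i}+T_{4i},\qquad \sigma_i^2=T_{1i}^2+T_{2i}^2+2T_{3i}^2+2T_{4i}^2+T_{5i}^2 .$$ Hence the expected acceptance rate satisfies $$\mathrm{E}[\alpha(x,y)]\to\Phi\big(\tfrac{\mu}{\sigma}\big)+e^{\mu+\sigma^2/2}\,\Phi\big(-\sigma-\tfrac{\mu}{\sigma}\big)\qquad\text{as } d\to\infty .$$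
   Context: $N(m,C)$ is the normal distribution with mean $m$ and covariance $C$; $\Phi$ is the standard normal cumulative distribution function; $\xrightarrow{\mathcal D}$ is convergence in distribution. For each $d$ the data are $A,M,N\in\mathbb{R}^{d\times d}$ and $b,\beta\in\mathbb{R}^d$ with $A$, $\mathcal{A}=M-N$ and $M^T+N$ symmetric positive definite and $M$ invertible (so $|G_i|<1$); all data and all quantities indexed by $i$ may depend on $d$, with this dependence suppressed in the notation. $A=Q\Lambda Q^T$ is a spectral decomposition with $Q$ orthogonal, $\Lambda=\operatorname{diag}(\lambda_1^2,\dots,\lambda_d^2)$, and $q_i$ is the $i$-th column of $Q$; ''$F$ is a function of $A$'' means $F=QF(\Lambda)Q^T$ with $F(\Lambda)$ obtained by applying a scalar function to the diagonal entries of $\Lambda$. $\pi$ is the target density, $q(x,\cdot)$ is the density of the proposal $y$ given $x$, and $\alpha(x,y)=1\wedge\frac{\pi(y)q(y,x)}{\pi(x)q(x,y)}$ is the acceptance probability. The expectation is over $x\sim N(A^{-1}b,A^{-1})$ and the proposal $y$ given $x$. *)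

(* Defs.v *)
From mathcomp Require Export all_boot all_order all_algebra.
From mathcomp Require Export all_classical all_reals all_analysis.
Export Order.TTheory GRing.Theory Num.Theory.
Export numFieldNormedType.Exports.

Set Implicit Arguments.
Unset Strict Implicit.
Unset Printing Implicit Defensive.

Local Open Scope classical_set_scope.
Local Open Scope ring_scope.

Section matrices.
Context {R : realType} {n : nat}.
Implicit Types (A C S Q F M N : 'M[R]_n) (v m b x y xi beta : 'cV[R]_n).

Definition quadform A v : R := (v^T *m A *m v) ord0 ord0.

Definition posdefmx A : Prop :=
  A^T = A /\ forall v, v != 0 -> 0 < quadform A v.

Definition is_sqrtmx C S : Prop :=
  [/\ S^T = S, forall v, 0 <= quadform S v & S *m S = C].

(* The positive semidefinite square root is unique, so the choice made by xget
   is immaterial. It exists whenever C is positive semidefinite; the default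
   value 0 is returned for the other matrices. *)
Definition sqrtmx C : 'M[R]_n := xget 0 [set S | is_sqrtmx C S].

Definition spectral_decomposition A Q (l : 'rV[R]_n) : Prop :=
  Q *m Q^T = 1%:M /\ A = Q *m diag_mx l *m Q^T.

(* F = Q f(L) Q^T, where L = diag_mx l and the scalar function f is applied to
   the diagonal entries of L. *)
Definition is_function_of Q (l : 'rV[R]_n) F : Prop :=
  exists f : R -> R, F = Q *m diag_mx (map_mx f l) *m Q^T.

Definition mvn_pdf m C v : R :=
  expR (- (quadform (invmx C) (v - m) / 2)) /
  Num.sqrt ((2 * pi) ^+ n * \det C).

(* The proposal comes from the splitting M - N of its own precision matrix
   (not of the target precision A), with iteration matrix G = M^-1 N. *)
Definition itermx M N : 'M[R]_n := invmx M *m N.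

Definition noise_cov M N : 'M[R]_n :=
  invmx (M - N) - itermx M N *m invmx (M - N) *m (itermx M N)^T.

Definition proposal_mean M N beta x : 'cV[R]_n :=
  itermx M N *m x + invmx M *m beta.

Definition proposal M N beta x xi : 'cV[R]_n :=
  proposal_mean M N beta x + sqrtmx (noise_cov M N) *m xi.

Definition target_pdf A b : 'cV[R]_n -> R := mvn_pdf (invmx A *m b) (invmx A).

Definition proposal_pdf M N beta x : 'cV[R]_n -> R :=
  mvn_pdf (proposal_mean M N beta x) (noise_cov M N).

End matrices.

Section metropolis_hastings.
Context {R : realType} {V : Type}.
Variables (p : V -> R) (q : V -> V -> R).

Definition mh_ratio (x y : V) : R := (p y * q y x) / (p x * q x y).

Definition acceptance (x y : V) : R := Num.min 1 (mh_ratio x y).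

End metropolis_hastings.

Section random_vectors.
Context {R : realType}.

(* Random vectors take values in n.-tuple R, which carries the product of the
   Borel sigma-algebras. *)
Definition cvec n (t : n.-tuple R) : 'cV[R]_n := \col_i tnth t i.

Context {disp : measure_display} {T : measurableType disp}.
Variable P : probability T R.

Definition independent {d1 d2 : measure_display} {T1 : measurableType d1}
    {T2 : measurableType d2} (X : T -> T1) (Y : T -> T2) : Prop :=
  forall (B : set T1) (C : set T2), measurable B -> measurable C ->
    P (X @^-1` B `&` Y @^-1` C) = (P (X @^-1` B) * P (Y @^-1` C))%E.

(* The product rule for all subfamilies follows by taking B i = setT outside
   of the subfamily. *)
Definition mutually_independent n (X : 'I_n -> T -> R) : Prop :=
  forall B : 'I_n -> set R, (forall i, measurable (B i)) ->
    P [set w | forall i, B i (X i w)] =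
    (\prod_(i < n) fine (P (X i @^-1` B i)))%:E.

Definition standard_normal n (Z : {RV P >-> n.-tuple R}) : Prop :=
  mutually_independent (fun i w => tnth (Z w) i) /\
  forall (i : 'I_n) (B : set R), measurable B ->
    P [set w | B (tnth (Z w) i)] = normal_prob (0 : R) 1 B.

(* X ~ N(m, C) for nonsingular C: X is an affine image m + L Z of a standard
   normal vector Z, with L L^T = C. *)
Definition mvn n (X : {RV P >-> n.-tuple R}) (m : 'cV[R]_n) (C : 'M[R]_n) :
    Prop :=
  exists (L : 'M[R]_n) (Z : {RV P >-> n.-tuple R}),
    [/\ standard_normal Z, L *m L^T = C &
        forall w, cvec (X w) = m + L *m cvec (Z w)].

End random_vectors.

(* Convergence of the cumulative distribution functions at every continuity
   point of the limit; the variables may live on different probability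
   spaces. *)
Definition cvg_in_distribution {R : realType} {disp : nat -> measure_display}
    {T : forall d, measurableType (disp d)} (P : forall d, probability (T d) R)
    (X : forall d, T d -> R) (nu : set R -> \bar R) : Prop :=
  (forall d, measurable_fun [set: T d] (X d)) /\
  forall t : R, nu [set t] = 0%E ->
    P d [set w | X d w <= t] @[d --> \oo] --> nu [set s | s <= t].

Definition Phi {R : realType} (t : R) : R :=
  fine (normal_prob (0 : R) 1 [set s | s <= t]).

Section coefficients.
Context {R : realType}.

(* Here l, tl, G, rh stand for lambda_i, tilde lambda_i, G_i, hat r_i. *)
Definition T_coef (l tl G rh : R) (j : nat) : R :=
  let tg := 1 - G in
  let g := 1 - G ^+ 2 in
  let r := (l ^+ 2 - tl ^+ 2) / l ^+ 2 in
  let tr := (l ^+ 2 - tl ^+ 2) / tl ^+ 2 in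
  match j with
  | 0%N => rh ^+ 2 * l ^+ 2 * (2^-1 * r * g - tg)
  | 1%N => rh * l * (r * g - tg)
  | 2%N => rh * l * Num.sqrt g * Num.sqrt (1 + tr) * (1 - r * G)
  | 3%N => 2^-1 * r * g
  | 4%N => - (2^-1 * r * g * (1 + tr))
  | 5%N => - (r * G * Num.sqrt g * Num.sqrt (1 + tr))
  | _ => 0
  end.

Definition mu_coef (T : nat -> R) : R := T 0%N + T 3%N + T 4%N.

Definition sigma2_coef (T : nat -> R) : R :=
  T 1%N ^+ 2 + T 2%N ^+ 2 + 2 * T 3%N ^+ 2 + 2 * T 4%N ^+ 2 + T 5%N ^+ 2.

Definition lyapunov_ratio (delta : R) n (t : 'I_n -> R) : R :=
  (\sum_(i < n) `|t i| `^ (2 + delta)) /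
  (\sum_(i < n) `|t i| ^+ 2) `^ (1 + delta / 2).

End coefficients.

(* Main.v *)
Require Import Defs.
From HB Require Import structures.
From mathcomp Require Import ring lra measurable_realfun charge.

(** In equilibrium x = A^-1 b + L z with z standard normal and L L^T = A^-1, so
    the log-ratio Z is a function of the standard normal vector W = (z, xi) of
    dimension 2d.  The proposal satisfies detailed balance with respect to
    N((M - N)^-1 beta, (M - N)^-1); the exponent of the ratio is therefore a
    difference of quadratic forms in x and y, all of them diagonal in the common
    eigenvectors q_i.  In the coordinates nu_i = lambda_i q_i^T (x - A^-1 b) and
    zeta_i = q_i^T xi it reads ([mh_ratio_eigen])
      Z = sum_i (T_0i + T_1i nu_i + T_2i zeta_i + T_3i nu_i^2 + T_4i zeta_i^2
                 + T_5i nu_i zeta_i),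
    and (nu, zeta) = O W for an orthogonal matrix O.  Hence Z is a quadratic
    polynomial Q(W) = c + a.W + W^T B W, and the quantities c + tr B,
    |a|^2 + 2 tr B^2, |B a|^2 and tr B^4, which O leaves unchanged, are sums of
    contributions of 2 x 2 blocks: the first two are sum_i mu_i and
    sum_i sigma_i^2, the last two are at most twice the sum of all T_ji^4
    ([mh_ratio_quadpoly]).  Only these four invariants enter the limit theorem.

    The limit theorem for Q(W) is obtained by the method of Stein.  Gaussian
    integration by parts, coordinate by coordinate, gives ([stein_quadpoly])
      E[(Q - E Q) f(Q)] = E[Gamma f'(Q)],   Gamma = (a + B W).(a + 2 B W).
    Gamma is again a quadratic polynomial in W.  The same identity, with f
    constant or affine, thus yields E Gamma = Var Q = |a|^2 + 2 tr B^2 and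
    Var Gamma = 9 |B a|^2 + 8 tr B^4.  For h bounded and continuous, the equation
    f'(u) - u f(u) = h(u) - E h(N(0,1)) has a solution with bounded derivative
    ([stein_equation_solution]); inserting it shows that E h(Q) - E h(N(0,1)) is
    E[f'(Q) (1 - Gamma)] when E Q = 0, which vanishes in the limit as soon as
    E Gamma tends to 1 and Var Gamma to 0 ([quadpoly_cvg_normal]).  A Lyapunov
    ratio that tends to 0 forces the largest T_ji^2 to be negligible against
    their bounded sum, so that the sums of T_ji^4 do tend to 0
    ([lyapunov_sum_pow4]).

    Both conclusions test Z against bounded continuous functions: distribution
    functions are squeezed between piecewise affine ones
    ([cvg_in_distribution_normal]), and the acceptance probability is
    min(1, e^Z), whose normal expectation follows by completing the square
    ([std_normal_integral_min1_expR]). *)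

Set Implicit Arguments.
Unset Strict Implicit.
Unset Printing Implicit Defensive.

Local Open Scope classical_set_scope.
Local Open Scope ring_scope.

(** * Integrals against a normal law *)

Section normal_integral.
Context {R : realType} (m s : R).
Local Notation mu := (@lebesgue_measure R).
Local Notation N := (normal_prob m s).
Local Notation p := (normal_pdf m s).

(** The two functions have the same integral over every measurable set. This
    gives access to the change of variables formula for Radon-Nikodym
    derivatives, hence to integrals against the normal law as integrals against
    its density. *)
Lemma normal_prob_density_ae :
  ae_eq mu setT (Radon_Nikodym_SigmaFinite.f N mu) (EFin \o p).
Proof.
have dom := normal_prob_dominates m s.
apply: integral_ae_eq => //.
- exact: Radon_Nikodym_SigmaFinite.f_integrable dom.
- by apply/measurable_EFinP; exact: measurable_normal_pdf.
- by move=> E _ mE; rewrite -Radon_Nikodym_SigmaFinite.f_integral.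
Qed.

Lemma ge0_integral_normal_prob (D : set R) (f : R -> \bar R) :
  measurable D -> measurable_fun setT f -> (forall x, (0 <= f x)%E) ->
  (\int[N]_(x in D) f x = \int[mu]_(x in D) (f x * (p x)%:E))%E.
Proof.
move=> mD mf f0; have dom := normal_prob_dominates m s.
have mfD := measurable_funTS mf.
rewrite -(Radon_Nikodym_SigmaFinite.change_of_variables dom f0 mD (mfD _))//.
apply: ae_eq_integral => //.
- apply: emeasurable_funM => //; first exact: mfD.
  apply: measurable_funTS.
  exact: measurable_int (Radon_Nikodym_SigmaFinite.f_integrable dom).
- apply: emeasurable_funM => //; first exact: mfD.
  by apply/measurable_EFinP; apply: measurable_funTS; exact: measurable_normal_pdf.
- apply: ae_eqe_mul2l; apply: filterS normal_prob_density_ae => x /= + _.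
  exact.
Qed.

Lemma integrable_normal_prob (f : R -> R) : measurable_fun setT f ->
  mu.-integrable setT (fun x => (f x * p x)%:E) <->
  N.-integrable setT (EFin \o f).
Proof.
move=> mf.
have mfp : measurable_fun setT (fun x => f x * p x).
  by apply: measurable_funM => //; exact: measurable_normal_pdf.
have E : (\int[N]_x `|(EFin \o f) x| = \int[mu]_x `|(f x * p x)%:E|)%E.
  rewrite ge0_integral_normal_prob//.
    by apply: eq_integral => x _; rewrite /= normrM (ger0_norm (normal_pdf_ge0 _ _ _)).
  by apply: measurableT_comp => //; exact/measurable_EFinP.
split=> /integrableP[_ foo]; apply/integrableP; split.
- exact/measurable_EFinP.
- by rewrite E.
- exact/measurable_EFinP.
- by rewrite -E.
Qed.

Lemma Rintegral_normal_prob (f : R -> R) : measurable_fun setT f ->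
  N.-integrable setT (EFin \o f) ->
  \int[N]_x f x = \int[mu]_x (f x * p x).
Proof.
move=> mf fi; rewrite /Rintegral; congr fine.
rewrite [LHS]integralE [RHS]integralE; congr (_ - _)%E.
- rewrite ge0_integral_normal_prob//; last first.
    by apply: measurable_funepos; exact/measurable_EFinP.
  apply: eq_integral => x _; rewrite /= !funeposE /= -!EFin_max -EFinM.
  by rewrite maxr_pMl ?mul0r ?normal_pdf_ge0.
- rewrite ge0_integral_normal_prob//; last first.
    by apply: measurable_funeneg; exact/measurable_EFinP.
  apply: eq_integral => x _; rewrite /= !funenegE /= -!EFin_max -EFinM.
  by rewrite maxr_pMl ?mul0r ?mulNr ?normal_pdf_ge0.
Qed.

End normal_integral.

(** * Integration by parts and the Stein equation on the line *)

Section gaussian_1d.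
Context {R : realType}.
Local Notation mu := (@lebesgue_measure R).
Local Notation N := (normal_prob (0 : R) 1).
Local Notation phi := (normal_pdf (0 : R) 1).

Lemma std_normal_pdfE (x : R) : phi x = normal_peak 1 * expR (- x ^+ 2 / 2).
Proof. by rewrite normal_pdfE ?oner_eq0// /normal_fun subr0 expr1n. Qed.

Lemma std_normal_pdfN (x : R) : phi (- x) = phi x.
Proof. by rewrite !std_normal_pdfE sqrrN. Qed.

Lemma std_normal_pdf_gt0 (x : R) : 0 < phi x.
Proof.
by rewrite std_normal_pdfE mulr_gt0 ?expR_gt0 ?normal_peak_gt0 ?oner_eq0.
Qed.

Lemma is_derive_std_normal_pdf (x : R) : is_derive x 1 phi (- x * phi x).
Proof.
have -> : phi = fun y => normal_peak 1 * expR (- y ^+ 2 / 2).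
  by apply/funext => y; rewrite std_normal_pdfE.
by apply: is_derive_eq; rewrite /GRing.scale /=; field.
Qed.

(** From (1 + |x|)^2 <= 2 (1 + x^2) and 1 + x^2 <= 8 e^(x^2/8), by squaring. *)
Lemma pow4_le_expR (x : R) : (1 + `|x|) ^+ 4 <= 256 * expR (x ^+ 2 / 4).
Proof.
have h1 : (1 + `|x|) ^+ 2 <= 2 * (1 + x ^+ 2).
  by rewrite -(real_normK (num_real x)); have := sqr_ge0 (1 - `|x|); nra.
have h2 : (1 + x ^+ 2) / 8 <= expR (x ^+ 2 / 8).
  by apply: le_trans (expR_ge1Dx _); lra.
have -> : x ^+ 2 / 4 = x ^+ 2 / 8 + x ^+ 2 / 8 by field.
rewrite expRD; have e0 := expR_gt0 (x ^+ 2 / 8).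
move: (expR _) h2 e0 => e h2 e0.
have := sqr_ge0 x; have := sqr_ge0 (1 + `|x|).
rewrite (_ : (1 + `|x|) ^+ 4 = (1 + `|x|) ^+ 2 * (1 + `|x|) ^+ 2); last by ring.
nra.
Qed.

Lemma pow4_pdf_le (x : R) :
  (1 + `|x|) ^+ 4 * phi x <= 256 * normal_peak 1 * expR (- x ^+ 2 / 4).
Proof.
have -> : - x ^+ 2 / 4 = - x ^+ 2 / 2 + x ^+ 2 / 4 by field.
rewrite std_normal_pdfE expRD.
have := pow4_le_expR x; have := expR_gt0 (- x ^+ 2 / 2).
have := @normal_peak_gt0 R 1 (oner_neq0 _) => p0 e0 h.
rewrite (_ : 256 * _ * _ = (256 * expR (x ^+ 2 / 4)) * (normal_peak 1 * expR (- x ^+ 2 / 2))); last by ring.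
by rewrite ler_wpM2r// mulr_ge0 ?ltW.
Qed.

(** Up to a factor, e^(-x^2/4) is the density of N(0, 2), which is integrable. *)
Lemma integrable_pow4_std_normal :
  N.-integrable setT (EFin \o (fun x : R => (1 + `|x|) ^+ 4)).
Proof.
have m4 : measurable_fun setT (fun x : R => (1 + `|x|) ^+ 4).
  by apply: measurable_funX; apply: measurable_funD.
apply/integrable_normal_prob => //.
set s := Num.sqrt (2 : R).
have s2 : s ^+ 2 = 2 by rewrite sqr_sqrtr.
have s0 : s != 0 by rewrite gt_eqF// sqrtr_gt0.
have q0 := normal_peak_gt0 s0.
apply: (@le_integrable _ _ _ mu _ measurableT _ (fun x => (256 * normal_peak 1 / normal_peak s)%:E * (normal_pdf 0 s x)%:E)%E).
- apply/measurable_EFinP; apply: measurable_funM => //.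
  exact: measurable_normal_pdf.
- move=> x _; rewrite -EFinM !abse_EFin lee_fin ger0_norm; last first.
    by rewrite mulr_ge0 ?normal_pdf_ge0// exprn_ge0// addr_ge0.
  rewrite ger0_norm; last first.
    by rewrite mulr_ge0 ?normal_pdf_ge0 ?divr_ge0 ?mulr_ge0 ?normal_peak_ge0 ?ler0n.
  apply: le_trans (pow4_pdf_le x) _.
  rewrite normal_pdfE// /normal_fun subr0 s2 mulrA divfK ?gt_eqF//.
  by rewrite (_ : 2 *+ 2 = 4 :> R)//; ring.
- by apply: integrableZl => //; exact: integrable_normal_pdf.
Qed.

Lemma is_derive_continuous (f df : R -> R) :
  (forall x : R, is_derive x 1 f (df x)) -> continuous f.
Proof.
move=> dfE x; have [/derivable1_diffP + _] := dfE x.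
exact: differentiable_continuous.
Qed.

Lemma cvg_integral_symmetric_itv (h : R -> R) :
  mu.-integrable setT (EFin \o h) ->
  (\int[mu]_(x in `[(- n%:R)%R, n%:R%R]) (h x)%:E)%E @[n --> \oo] -->
  (\int[mu]_x (h x)%:E)%E.
Proof.
move=> hi; have mh := measurable_int _ hi.
pose f_ n x := ((EFin \o h) \_ (`[- n%:R, n%:R]%classic : set R)) x.
have := @dominated_convergence _ _ _ mu _ measurableT f_ (EFin \o h)
  (abse \o (EFin \o h)).
case.
- by move=> n; apply/(measurable_restrictT _ _).1 => //; exact: measurable_funTS.
- by [].
- apply: aeW => x _; apply: cvg_near_cst.
  near=> n; rewrite /f_ patchE mem_set//= in_itv/= -ler_norml.
  by near: n; exact: nbhs_infty_ger.
- exact: integrable_abse.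
- apply: aeW => x n _; rewrite /f_ patchE; case: ifPn => //= _.
  by rewrite lee_fin normr0.
move=> _ _; rewrite /f_.
apply: cvg_trans; apply: near_eq_cvg; near=> n.
by rewrite /= [RHS]integral_mkcond.
Unshelve. all: by end_near. Qed.

Lemma integrable_std_normal_pow4 (f : R -> R) (K : R) :
  measurable_fun setT f -> (forall x, `|f x| <= K * (1 + `|x|) ^+ 4) ->
  N.-integrable setT (EFin \o f).
Proof.
move=> mf bf; apply: (@le_integrable _ _ _ N _ measurableT _
  (fun x => K%:E * ((1 + `|x|) ^+ 4)%:E)%E).
- exact/measurable_EFinP.
- move=> x _; rewrite -EFinM !abse_EFin lee_fin.
  exact: le_trans (bf x) (ler_norm _).
- by apply: integrableZl => //; exact: integrable_pow4_std_normal.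
Qed.

(** The derivative of g phi is (dg - x g) phi, whose integral over [-n, n] is a
    boundary term that tends to 0. Growth of degree 4 suffices for what follows:
    there g is an affine factor times a function of linear growth evaluated at a
    quadratic polynomial, and the factor x adds one more degree. *)
Lemma gaussian_ibp_1d (g dg : R -> R) (K : R) :
  (forall x : R, is_derive x 1 g (dg x)) -> continuous dg ->
  (forall x, `|x * g x| <= K * (1 + `|x|) ^+ 4) ->
  (forall x, `|dg x| <= K * (1 + `|x|) ^+ 4) ->
  \int[N]_x (x * g x) = \int[N]_x dg x.
Proof.
move=> dgE cdg bg bdg.
have cg := is_derive_continuous dgE.
have mg := continuous_measurable_fun cg.
have mdg := continuous_measurable_fun cdg.
have mxg : measurable_fun setT (fun x : R => x * g x) by exact: measurable_funM.
have ixg := integrable_std_normal_pow4 mxg bg.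
have idg := integrable_std_normal_pow4 mdg bdg.
apply/eqP; rewrite -subr_eq0 -opprB oppr_eq0 -RintegralB//.
have idiff := integrableB measurableT idg ixg.
rewrite Rintegral_normal_prob//; last exact: measurable_funB.
pose G := fun x => g x * phi x.
pose h := fun x => (dg x - x * g x) * phi x.
have dG (x : R) : is_derive x 1 G (h x).
  have d1 := dgE x; have d2 := is_derive_std_normal_pdf x.
  by apply: is_derive_eq; rewrite /h /GRing.scale /=; ring.
have ch : continuous h.
  move=> x; apply: cvgM; last by apply: continuous_normal_pdf; rewrite oner_eq0.
  by apply: cvgB; [exact: cdg|apply: cvgM => //; exact: cg].
have cG := is_derive_continuous dG.
have ih : mu.-integrable setT (EFin \o h).
  by apply/integrable_normal_prob => //; exact: measurable_funB.
have FTC (n : nat) : (0 < n)%N ->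
    (\int[mu]_(x in `[(- n%:R)%R, n%:R%R]) (h x)%:E = (G n%:R - G (- n%:R))%:E)%E.
  move=> n0; rewrite EFinB; apply: continuous_FTC2.
  - by rewrite gtrN// ltr0n.
  - exact: continuous_subspaceT.
  - split.
    + by move=> x _; have [] := dG x.
    + exact: cvg_at_right_filter (cG _).
    + exact: cvg_at_left_filter (cG _).
  - by move=> x _; rewrite derive1E; have [] := dG x.
have Gsmall x : 1 <= `|x| -> `|G x| <= (`|K| * 256 * normal_peak 1) / `|x|.
  move=> x1; have x0 : 0 < `|x| by exact: lt_le_trans x1.
  rewrite ler_pdivlMr// -normrM /G mulrC mulrA normrM (ger0_norm (normal_pdf_ge0 _ _ _)).
  have h1 : `|x * g x| * phi x <= `|K| * ((1 + `|x|) ^+ 4 * phi x).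
    rewrite mulrA ler_wpM2r ?normal_pdf_ge0//.
    by apply: le_trans (bg x) _; rewrite ler_wpM2r ?ler_norm.
  apply: le_trans h1 _; rewrite -mulrA ler_wpM2l//.
  apply: le_trans (pow4_pdf_le x) _.
  rewrite ler_piMr ?mulr_ge0 ?normal_peak_ge0 ?ler0n//.
  by rewrite -expR0 ler_expR mulNr oppr_le0 divr_ge0// sqr_ge0.
have L1 : (\int[mu]_(x in `[(- n%:R)%R, n%:R%R]) (h x)%:E)%E @[n --> \oo] --> 0%E.
  set C := `|K| * 256 * normal_peak 1 in Gsmall.
  have C0 : 0 <= C by rewrite /C !mulr_ge0 ?normal_peak_ge0 ?ler0n.
  have L : G n%:R - G (- n%:R) @[n --> \oo] --> (0 : R).
    have H0 : (4 * C) * harmonic n @[n --> \oo] --> (0 : R).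
      by rewrite -[X in _ --> X](mulr0 (4 * C)); apply: cvgMr; exact: cvg_harmonic.
    apply: (@squeeze_cvgr _ _ _ _ (fun n => - (4 * C * harmonic n)) (fun n => 4 * C * harmonic n)).
    - near=> n; rewrite -ler_norml.
      have n1 : (1 <= n)%N by near: n; exact: nbhs_infty_ge.
      have n1R : 1 <= `|n%:R : R| by rewrite normr_nat ler1n.
      apply: le_trans (ler_normB _ _) _.
      have := Gsmall _ n1R; have := Gsmall (- n%:R); rewrite normrN => /(_ n1R).
      rewrite normr_nat => h1 h2; apply: le_trans (lerD h2 h1) _.
      have -> : 4 * C * harmonic n = C * (4 / n.+1%:R) by rewrite /harmonic /=; ring.
      rewrite -mulrDr ler_wpM2l//.
      have n0 : 0 < n%:R :> R by rewrite ltr0n.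
      have n01 : 0 < n.+1%:R :> R by rewrite ltr0n.
      rewrite -(@ler_pM2r _ (n%:R * n.+1%:R)) ?mulr_gt0//.
      rewrite -natr1 in n01 *.
      have -> : (n%:R^-1 + n%:R^-1) * (n%:R * (n%:R + 1)) = 2 * (n%:R + 1) :> R.
        by field; rewrite gt_eqF.
      have -> : 4 / (n%:R + 1) * (n%:R * (n%:R + 1)) = 4 * n%:R :> R.
        by field; rewrite gt_eqF.
      by move: n1R; rewrite normr_nat; lra.
    - by rewrite -[X in _ --> X]oppr0; apply: cvgN.
    - exact: H0.
  apply: (@cvg_trans _ (EFin \o (fun n : nat => G n%:R - G (- n%:R)) @ \oo)).
    apply: near_eq_cvg; near=> n.
    by rewrite FTC//; near: n; exact: nbhs_infty_ge.
  apply: cvg_EFin; last exact: L.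
  by apply: nearW => n.
have := cvg_unique _ L1 (cvg_integral_symmetric_itv ih).
by rewrite /Rintegral => <-//.
Unshelve. all: by end_near. Qed.

Lemma std_normal_probN (A : set R) : measurable A ->
  N (-%R @^-1` A) = N A.
Proof.
move=> mA; rewrite /normal_prob.
have mN : measurable_fun setT (-%R : R -> measurableTypeR R).
  exact: oppr_measurable.
transitivity (\int[pushforward mu (-%R : R -> measurableTypeR R)]_(x in A) (phi x)%:E)%E.
  rewrite ge0_integral_pushforward.
  - by apply: eq_integral => x _ /=; rewrite std_normal_pdfN.
  - exact: mN.
  - exact: mA.
  - apply/measurable_EFinP; apply: measurable_funTS; exact: measurable_normal_pdf.
  - by move=> x _; rewrite lee_fin normal_pdf_ge0.
by apply: eq_measure_integral => B mB _; exact: lebesgue_measureN.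
Qed.

Lemma cvg_std_normal_pdfy : phi x @[x --> +oo] --> (0 : R).
Proof.
have L : normal_peak 1 * expR (- x) @[x --> +oo] --> (0 : R).
  by rewrite -[X in _ --> X](mulr0 (normal_peak 1)); apply: cvgMr; exact: cvgr_expR.
apply: (@squeeze_cvgr _ _ _ _ (fun=> 0) (fun x => normal_peak 1 * expR (- x))).
- near=> x; rewrite normal_pdf_ge0 std_normal_pdfE ler_wpM2l ?normal_peak_ge0//.
  rewrite ler_expR.
  have : 2 <= x by near: x; exact: nbhs_pinfty_ge.
  nra.
- exact: cvg_cst.
- exact: L.
Unshelve. all: by end_near. Qed.

(** On [x, +oo[ one has x phi(y) <= y phi(y), and y phi(y) is the derivative of
    - phi(y). *)
Lemma std_normal_mills (x : R) : 0 <= x ->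
  (x%:E * N (`[x, +oo[) <= (phi x)%:E)%E.
Proof.
move=> x0; rewrite /normal_prob -ge0_integralZl//; last first.
- by move=> y _; rewrite lee_fin normal_pdf_ge0.
- apply/measurable_EFinP; apply: measurable_funTS; exact: measurable_normal_pdf.
have cphi : continuous phi by apply: continuous_normal_pdf; rewrite oner_eq0.
have cyphi : continuous (fun y : R => y * phi y).
  by move=> y; apply: cvgM => //; exact: cphi.
have FTC : (\int[mu]_(y in `[x, +oo[) (y * phi y)%:E = 0%:E - (- phi x)%:E)%E.
  apply: (@ge0_continuous_FTC2y _ _ (fun y => - phi y)).
  - by move=> y xy; rewrite mulr_ge0 ?normal_pdf_ge0 ?(le_trans x0).
  - exact: continuous_subspaceT.
  - by rewrite -[X in _ --> X]oppr0; apply: cvgN; exact: cvg_std_normal_pdfy.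
  - by move=> y _; apply: derivableN; have [] := is_derive_std_normal_pdf y.
  - by apply: cvgN; apply: cvg_at_right_filter; exact: cphi.
  - move=> y _; have d := is_derive_std_normal_pdf y.
    by rewrite derive1E derive_val; lra.
rewrite (_ : (phi x)%:E = 0%:E - (- phi x)%:E)%E; last by rewrite EFinN oppeK add0e.
rewrite -FTC; apply: ge0_le_integral => //.
- by move=> y _; rewrite -EFinM lee_fin mulr_ge0 ?normal_pdf_ge0.
- suff: measurable_fun `[x, +oo[ (EFin \o (fun y : R => x * phi y)) by [].
  apply/measurable_EFinP; apply: measurable_funTS; apply: measurable_funM => //.
  exact: measurable_normal_pdf.
- apply/measurable_EFinP; apply: measurable_funTS; exact: continuous_measurable_fun.
- move=> y; rewrite /= in_itv/= andbT => xy.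
  by rewrite lee_fin ler_wpM2r ?normal_pdf_ge0.
Qed.

Lemma ge0_le_std_normal_pdf_tail (x : R) : 0 <= x ->
  x * fine (N `]x, +oo[) <= phi x /\ x * fine (N `]-oo, - x]) <= phi x.
Proof.
move=> x0; have := std_normal_mills x0.
have fN (A : set R) : measurable A -> N A \is a fin_num.
  by move=> mA; exact: (@fin_num_measure _ _ _ N).
rewrite -(fineK (fN _ _))// -EFinM lee_fin => h; split.
  apply: le_trans h; rewrite ler_wpM2l// fine_le ?fN//.
  apply: le_measure; rewrite ?inE// => y /=.
  by rewrite !in_itv/= !andbT => /ltW.
have := @std_normal_probN `[x, +oo[ (measurable_itv _).
by rewrite opp_preimage_itvbndy /= => ->.
Qed.

(** The solution is f = F / phi, where F(x) is the integral of
    k = h - E h(N(0,1)) against phi over ]-oo, x]. Since k phi has total integral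
    0, F is also minus the integral over ]x, +oo[; using the tail on the side of
    x, the bound x (tail) <= phi(x) makes x f, and therefore f' = k + x f,
    bounded. *)
Lemma stein_equation_solution (h : R -> R) (K : R) :
  continuous h -> (forall x, `|h x| <= K) ->
  exists f df : R -> R, [/\ forall x : R, is_derive x 1 f (df x), continuous df,
    exists C : R, forall x, `|df x| <= C &
    forall x, df x - x * f x = h x - \int[N]_y h y].
Proof.
move=> ch bh; set I := \int[N]_y h y.
have mh := continuous_measurable_fun ch.
pose k := fun x => h x - I.
have ck : continuous k by move=> x; apply: cvgB; [exact: ch|exact: cvg_cst].
have mk := continuous_measurable_fun ck.
have [C [C0 bk]] : exists C, 0 <= C /\ forall x, `|k x| <= C.
  exists (K + `|I|); split.
    by rewrite addr_ge0// (le_trans (normr_ge0 (h 0))).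
  by move=> x; apply: le_trans (ler_normB _ _) _; rewrite lerD2r.
have cphi : continuous phi by apply: continuous_normal_pdf; rewrite oner_eq0.
pose kp := fun x => k x * phi x.
have ckp : continuous kp by move=> x; apply: cvgM; [exact: ck|exact: cphi].
have bounded_int (u : R -> R) (D : R) : measurable_fun setT u -> (forall x, `|u x| <= D) ->
    N.-integrable setT (EFin \o u).
  move=> mu' bu; apply: (@le_integrable _ _ _ N _ measurableT _ (EFin \o cst D)).
  - exact/measurable_EFinP.
  - by move=> x _; rewrite lee_fin; exact: le_trans (bu x) (ler_norm _).
  - exact: finite_measure_integrable_cst.
have ih := bounded_int _ _ mh bh.
have ik := bounded_int _ _ mk bk.
have ikp : mu.-integrable setT (EFin \o kp) by exact/integrable_normal_prob.
pose F := fun x : R => \int[mu]_(t in `]-oo, x]) kp t.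
have dF (x : R) : is_derive x 1 F (kp x).
  have x1 : x < x + 1 by rewrite ltrDl.
  have [] := continuous_FTC1 (a := -oo%O) x1 _ _ (ckp x).
  - exact: integrableS ikp.
  - by rewrite ltNyr.
  by move=> d1 <-; rewrite derive1E; exact: DeriveDef.
have k0 : \int[mu]_x kp x = 0.
  rewrite -(Rintegral_normal_prob mk)// RintegralB//; last first.
    exact: finite_measure_integrable_cst.
  rewrite Rintegral_cst//.
  rewrite [X in fine X](_ : _ = 1%E) ?mulr1 ?subrr//.
  exact: (@probability_setT _ _ _ N).
have intb (A : set R) : measurable A -> `|\int[mu]_(x in A) kp x| <= C * fine (N A).
  move=> mA; have ikA : mu.-integrable A (EFin \o kp) by exact: integrableS ikp.
  apply: le_trans (le_normr_Rintegral _ _) _ => //.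
  have ip : mu.-integrable A (fun x => (phi x)%:E).
    by apply: integrableS (integrable_normal_pdf 0 1).
  have -> : C * fine (N A) = \int[mu]_(x in A) (C * phi x) by rewrite RintegralZl.
  apply: le_Rintegral => //.
  - exact: integrable_norm.
  - by have := fun m => integrableZl m C ip; apply; exact: mA.
  - move=> x _; rewrite /kp normrM (ger0_norm (normal_pdf_ge0 _ _ _)).
    by rewrite ler_wpM2r ?normal_pdf_ge0.
have bF x : `|x * F x| <= C * phi x.
  have [x0|/ltW x0] := leP 0 x; rewrite normrM.
    rewrite (ger0_norm x0).
    have -> : F x = - \int[mu]_(t in `]x, +oo[) kp t.
      apply/eqP; rewrite -addr_eq0 /F -Rintegral_setU//.
      - by rewrite itv_setU_setT ?k0.
      - by rewrite itv_setU_setT.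
      - apply/disj_setPS => y [] /=; rewrite !in_itv/= andbT => h1 h2.
        by have := lt_le_trans h2 h1; rewrite ltxx.
    rewrite normrN; apply: (le_trans (ler_wpM2l x0 (intb _ _))) => //.
    have [+ _] := ge0_le_std_normal_pdf_tail x0.
    by move/(ler_wpM2l C0); rewrite mulrCA.
  have x0' : 0 <= - x by rewrite oppr_ge0.
  rewrite (ler0_norm x0).
  apply: (le_trans (ler_wpM2l x0' (intb _ _))) => //.
  have [_ +] := ge0_le_std_normal_pdf_tail x0'.
  by rewrite opprK std_normal_pdfN => /(ler_wpM2l C0); rewrite mulrCA.
pose f := fun x => F x / phi x.
pose df := fun x => k x + x * f x.
have phi0 x : phi x != 0 by rewrite gt_eqF// std_normal_pdf_gt0.
have df_f (x : R) : is_derive x 1 f (df x).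
  have d1 := dF x; have d2 := is_derive_std_normal_pdf x.
  have d3 := is_deriveV (phi0 x) d2.
  apply: is_derive_eq.
  rewrite /GRing.scale /= /df /f /kp; field; exact: phi0.
have cf := is_derive_continuous df_f.
exists f, df; split => //.
- move=> x; apply: cvgD; first exact: ck.
  by apply: cvgM => //; exact: cf.
- exists (C + C) => x; apply: le_trans (ler_normD _ _) _.
  apply: lerD => //; rewrite /f mulrA normrM normfV.
  rewrite (gtr0_norm (std_normal_pdf_gt0 x)) ler_pdivrMr ?std_normal_pdf_gt0//.
- by move=> x; rewrite /df addrK.
Qed.

End gaussian_1d.

(** * Integration by parts in one independent coordinate *)

Section independent_ibp.
Context {R : realType} {d d' : measure_display} {T : measurableType d}
  {T' : measurableType d'} (P : probability T R).
Local Notation N := (normal_prob (0 : R) 1).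
Local Notation RR := (measurableTypeR R).

Variables (X : T -> RR) (Y : T -> T').
Hypotheses (mX : measurable_fun setT X) (mY : measurable_fun setT Y).
Hypothesis XN_indepY : forall (A : set RR) (D : set T'),
  measurable A -> measurable D ->
  P (X @^-1` A `&` Y @^-1` D) = (N A * P (Y @^-1` D))%E.

(** The law of (X, Y) is a product measure, by uniqueness on rectangles; the
    claim is then the theorem of Fubini. *)
Lemma integral_indep_std_normal (F : RR * T' -> R) :
  measurable_fun setT F ->
  P.-integrable setT (fun w => (F (X w, Y w))%:E) ->
  (\int[P]_w (F (X w, Y w))%:E =
   \int[pushforward P Y]_y \int[N]_u (F (u, y))%:E)%E.
Proof.
move=> mF iF.
pose Ym : {mfun T >-> T'} := HB.pack Y (isMeasurableFun.Build _ _ _ _ Y mY).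
have mXY : measurable_fun setT (fun w => (X w, Y w)) by exact: measurable_fun_pair.
pose XY : {mfun T >-> (RR * T')%type} :=
  HB.pack (fun w => (X w, Y w)) (isMeasurableFun.Build _ _ _ _ _ mXY).
have mF' : measurable_fun setT (EFin \o F) by exact/measurable_EFinP.
have lawE A : measurable A -> (N \x distribution P Ym)%E A = distribution P XY A.
  exact: product_measure_unique.
have <- : (\int[N \x distribution P Ym]_z (F z)%:E = \int[P]_w (F (X w, Y w))%:E)%E.
  rewrite -(integral_distribution (X := XY) mF' iF).
  by apply: eq_measure_integral => A mA _; exact: lawE.
have -> : (\int[pushforward P Y]_y \int[N]_u (F (u, y))%:E =
   \int[distribution P Ym]_y \int[N]_u (F (u, y))%:E)%E by [].
rewrite (@integral21_prod_meas1 _ _ _ _ _ N (distribution P Ym) (EFin \o F))//.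
apply/integrableP; split => //.
have [_] := (integrableP _ _ _ iF).
rewrite (eq_measure_integral (distribution P XY)); last by move=> A mA _; exact: lawE.
by rewrite ge0_integral_distribution//; exact: measurableT_comp.
Qed.

(** Integration by parts on the line, applied to g(., y) for each value y of Y. *)
Lemma indep_std_normal_ibp (g dg : RR * T' -> R) :
  measurable_fun setT g -> measurable_fun setT dg ->
  P.-integrable setT (fun w => (X w * g (X w, Y w))%:E) ->
  P.-integrable setT (fun w => (dg (X w, Y w))%:E) ->
  (forall y (x : R), is_derive x 1 (fun u => g (u, y)) (dg (x, y))) ->
  (forall y, continuous (fun u : R => dg (u, y))) ->
  (forall y, exists K : R, forall x : R,
     `|x * g (x, y)| <= K * (1 + `|x|) ^+ 4 /\
     `|dg (x, y)| <= K * (1 + `|x|) ^+ 4) ->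
  \int[P]_w (X w * g (X w, Y w)) = \int[P]_w dg (X w, Y w).
Proof.
move=> mg mdg ig idg gdg cdg bg.
have mug : measurable_fun setT (fun z : RR * T' => (z.1 : R) * g z).
  by apply: measurable_funM => //; exact: measurable_fst.
have e y : (\int[N]_u (u * g (u, y))%:E = \int[N]_u (dg (u, y))%:E)%E.
  have [K bK] := bg y.
  have cg := is_derive_continuous (gdg y).
  have b1 (x : R) := (bK x).1; have b2 (x : R) := (bK x).2.
  have mu1 : measurable_fun setT (fun u : R => u * g (u, y)).
    by apply: measurable_funM => //; exact: continuous_measurable_fun cg.
  have mu2 := continuous_measurable_fun (cdg y).
  have i1 := integrable_std_normal_pow4 mu1 b1.
  have i2 := integrable_std_normal_pow4 mu2 b2.
  rewrite -[LHS]fineK ?integrable_fin_num// -[RHS]fineK ?integrable_fin_num//.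
  by congr EFin; exact: gaussian_ibp_1d (gdg y) (cdg y) b1 b2.
rewrite /Rintegral; congr fine.
rewrite (integral_indep_std_normal mug ig) (integral_indep_std_normal mdg idg).
by congr (integral _ _ _); apply/funext => y; exact: e.
Qed.

End independent_ibp.

Section gaussian_family.
Context {R : realType} {d : measure_display} {T : measurableType d}
  (P : probability T R).
Local Notation N := (normal_prob (0 : R) 1).
Local Notation RR := (measurableTypeR R).

Definition gaussian_family m (W : 'I_m -> T -> R) : Prop :=
  (forall k, measurable_fun setT (W k)) /\
  forall B : 'I_m -> set R, (forall k, measurable (B k)) ->
    P [set w | forall k, B k (W k w)] = (\prod_(k < m) fine (N (B k)))%:E.

(** Boxes are stable under intersection, unlike the one-coordinate cylinders
    from which the product sigma-algebra is built; measures can thus be compared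
    on boxes. *)
Lemma measurable_tuple_boxes m :
  @measurable _ (m.-tuple R) = <<s [set D : set (m.-tuple R) |
    exists2 B : 'I_m -> set R, forall k, measurable (B k) &
      D = [set t | forall k, B k (tnth t k)]] >>.
Proof.
rewrite eqEsubset; split; last first.
  apply: smallest_sub; first exact: sigma_algebra_measurable.
  move=> _ [B mB ->].
  rewrite (_ : [set t | _] = \bigcap_(k in [set: 'I_m]) ((@tnth m R)^~ k @^-1` B k)).
    apply: fin_bigcap_measurable => // k _; rewrite -[X in measurable X]setTI.
    exact: measurable_tnth.
  by apply/seteqP; split => t /= h k; [move=> _; exact: h|exact: (h k)].
apply: smallest_sub; first exact: smallest_sigma_algebra.
elim/big_ind : _ => //.
- by move=> A B hA hB D [/hA|/hB].
- move=> i _ D [A mA <-]; apply: sub_gen_smallest.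
  exists (fun k => if k == i then A else setT).
    by move=> k; case: ifP.
  rewrite setTI; apply/seteqP; split => t /=.
    by move=> tA k; case: eqP => // ->.
  by move=> /(_ i); rewrite eqxx.
Qed.

(** For fixed A both sides are finite measures in D, and they agree on boxes. *)
Lemma indep_std_normal_of_boxes m (X : T -> RR) (Y : T -> m.-tuple R) :
  measurable_fun setT X -> measurable_fun setT Y ->
  (forall (A : set R) (B : 'I_m -> set R), measurable A ->
    (forall k, measurable (B k)) ->
    P (X @^-1` A `&` Y @^-1` [set t | forall k, B k (tnth t k)]) =
    (N A * P (Y @^-1` [set t | forall k, B k (tnth t k)]))%E) ->
  forall (A : set RR) (D : set (m.-tuple R)), measurable A -> measurable D ->
  P (X @^-1` A `&` Y @^-1` D) = (N A * P (Y @^-1` D))%E.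
Proof.
move=> mX mY XY A D mA mD.
have mXA : measurable (X @^-1` A) by rewrite -[X in measurable X]setTI; exact: mX.
have fN : N A \is a fin_num by exact: (@fin_num_measure _ _ _ N).
have N0 : 0 <= fine (N A) by rewrite fine_ge0.
pose c : {nonneg R} := NngNum N0.
pose law (nu : {measure set T -> \bar R}) : {measure set (m.-tuple R) -> \bar R} :=
  measure_function_pushforward__canonical__measure_function_Measure nu mY.
have H : law (mrestr P mXA) D = mscale c (law P) D.
  apply: (measure_unique _ (fun=> setT) (measurable_tuple_boxes m)) => //.
  - move=> _ _ [B1 mB1 ->] [B2 mB2 ->]; exists (fun k => B1 k `&` B2 k).
      by move=> k; exact: measurableI.
    apply/seteqP; split => t /=; first by move=> [h1 h2] k; split.
    by move=> h; split => k; case: (h k).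
  - by move=> i; exists (fun=> setT) => //; apply/seteqP; split.
  - by rewrite bigcup_const//.
  - move=> _ [B mB ->].
    rewrite /= /pushforward /mscale /mrestr /= fineK// setIC.
    exact: XY.
  - move=> k; rewrite /= /pushforward /mrestr preimage_setT setTI.
    by rewrite ltey_eq (@fin_num_measure _ _ _ P).
by move: H; rewrite /= /pushforward /mscale /mrestr /= fineK// setIC.
Qed.

(** Coordinate k is independent of the others. These are kept as a tuple of the
    same length, with 0 in place of coordinate k. *)
Lemma gaussian_coordinate_indep m (W : 'I_m -> T -> R) (k : 'I_m) :
  gaussian_family W ->
  let Y w := [tuple (if j == k then 0 else W j w) | j < m] in
  measurable_fun setT Y /\
  forall (A : set RR) (D : set (m.-tuple R)), measurable A -> measurable D ->
  P (W k @^-1` A `&` Y @^-1` D) = (N A * P (Y @^-1` D))%E.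
Proof.
move=> [mW gW] Y.
have mY : measurable_fun setT Y.
  apply/measurable_fun_tnthP => j.
  rewrite (_ : _ \o _ = fun w => if j == k then 0 else W j w).
    by case: eqP => _; [exact: measurable_cst|exact: mW].
  by apply/funext => w; rewrite /= tnth_mktuple.
split=> //; apply: indep_std_normal_of_boxes => //; first exact: mW.
move=> A B mA mB.
have fN (C : set R) : measurable C -> N C \is a fin_num.
  by move=> mC; exact: (@fin_num_measure _ _ _ N).
(* The event that Y lies in the box B, and that event together with W k in A,
   are boxes for W; at the index k they depend on whether B k contains the
   constant entry 0 of Y. *)
pose C0 j := if j == k then (if 0 \in B k then setT else set0) else B j.
pose C1 j := if j == k then (if 0 \in B k then A else set0) else B j.
have mC0 j : measurable (C0 j) by rewrite /C0; case: ifP => // _; case: ifP.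
have mC1 j : measurable (C1 j) by rewrite /C1; case: ifP => // _; case: ifP.
have -> : Y @^-1` [set t | forall j, B j (tnth t j)] =
    [set w | forall j, C0 j (W j w)].
  apply/seteqP; split => w /= h j; have := h j; rewrite tnth_mktuple /C0;
    case: eqP => [->|//].
    by move=> Bk; rewrite mem_set.
  by case: ifPn => // /set_mem.
have -> : W k @^-1` A `&` [set w | forall j, C0 j (W j w)] =
    [set w | forall j, C1 j (W j w)].
  apply/seteqP; split => w /=.
    move=> [Ak h] j; have := h j; rewrite /C0 /C1; case: eqP => [->|//].
    by case: ifP.
  move=> h; split.
    by have := h k; rewrite /C1 eqxx; case: ifP.
  by move=> j; have := h j; rewrite /C0 /C1; case: eqP => [->|//]; case: ifP.
rewrite !gW//.
rewrite -(fineK (fN A mA)) -EFinM; congr EFin.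
rewrite (bigD1 k)//= [in RHS](bigD1 k)//= mulrA; congr (_ * _); last first.
  by apply: eq_bigr => j /negbTE jk; rewrite /C0 /C1 jk.
rewrite /C0 /C1 eqxx; case: ifP => _.
  rewrite (_ : fine (N setT) = 1) ?mulr1//.
  by rewrite [X in fine X](_ : _ = 1%E)//; exact: (@probability_setT _ _ _ N).
by rewrite measure0 /= mulr0.
Qed.

End gaussian_family.

(** * Integration by parts for a standard normal vector *)

Section growth.
Context {R : realType} {m : nat}.
Implicit Types (v : 'cV[R]_m) (F G : 'cV[R]_m -> R).

(** The summand 1 makes the powers of the weight increase, and makes the weight
    submultiplicative under a shift along a coordinate axis ([weight_shift]). *)
Definition weight v : R := 1 + \sum_k `|v k ord0|.

Definition poly_growth (n : nat) F : Prop :=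
  exists K : R, forall v, `|F v| <= K * weight v ^+ n.

(** Composition with any family of measurable coordinates, because the
    vectors arise both on the probability space and on the product in which one coordinate
    varies alone. *)
Definition coord_measurable F : Prop :=
  forall (d : measure_display) (S : measurableType d) (V : S -> 'cV[R]_m),
    (forall k, measurable_fun setT (fun s => V s k ord0)) ->
    measurable_fun setT (fun s => F (V s)).

Lemma weight_ge1 v : 1 <= weight v.
Proof. by rewrite lerDl sumr_ge0. Qed.

Lemma weight_ge0 v : 0 <= weight v.
Proof. by apply: le_trans (weight_ge1 v). Qed.

Lemma poly_growth_pos n F : poly_growth n F ->
  exists2 K : R, 0 <= K & forall v, `|F v| <= K * weight v ^+ n.
Proof.
move=> [K FK]; exists `|K| => // v; apply: le_trans (FK v) _.
by rewrite ler_wpM2r ?ler_norm// exprn_ge0// weight_ge0.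
Qed.

Lemma poly_growthD n F G : poly_growth n F -> poly_growth n G ->
  poly_growth n (fun v => F v + G v).
Proof.
move=> [K FK] [L GL]; exists (K + L) => v.
by rewrite mulrDl; apply: le_trans (ler_normD _ _) _; exact: lerD.
Qed.

Lemma poly_growthM p q F G : poly_growth p F -> poly_growth q G ->
  poly_growth (p + q) (fun v => F v * G v).
Proof.
move=> /poly_growth_pos[K K0 FK] /poly_growth_pos[L L0 GL]; exists (K * L) => v.
by rewrite normrM exprD mulrACA; exact: ler_pM.
Qed.

Lemma poly_growth_cst n (c : R) : poly_growth n (fun=> c).
Proof.
exists `|c| => v; rewrite ler_peMr//; exact/exprn_ege1/weight_ge1.
Qed.

Lemma poly_growth_coord k : poly_growth 1 (fun v => v k ord0).
Proof.
exists 1 => v; rewrite mul1r expr1 /weight (bigD1 k)//= addrCA lerDl.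
by rewrite addr_ge0// sumr_ge0.
Qed.

Lemma poly_growth_sum n (I : Type) (s : seq I) (F : I -> 'cV[R]_m -> R) :
  (forall i, poly_growth n (F i)) -> poly_growth n (fun v => \sum_(i <- s) F i v).
Proof.
move=> FK; elim: s => [|i s IH].
  by have [K HK] := poly_growth_cst n 0; exists K => v; rewrite big_nil.
have [K HK] := poly_growthD (FK i) IH; exists K => v.
by rewrite big_cons.
Qed.

Lemma poly_growthW p q F : (p <= q)%N -> poly_growth p F -> poly_growth q F.
Proof.
move=> pq /poly_growth_pos[K K0 FK]; exists K => v; apply: le_trans (FK v) _.
by rewrite ler_wpM2l// ler_weXn2l// weight_ge1.
Qed.

Lemma poly_growth_comp n F (f : R -> R) (C : R) :
  (forall s, `|f s| <= C * (1 + `|s|)) -> poly_growth n F ->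
  poly_growth n (fun v => f (F v)).
Proof.
move=> fC /poly_growth_pos[K K0 FK]; exists (`|C| * (1 + K)) => v.
apply: le_trans (fC _) _.
have h : 1 + `|F v| <= (1 + K) * weight v ^+ n.
  by rewrite mulrDl mul1r lerD// exprn_ege1// weight_ge1.
rewrite -mulrA; apply: le_trans (ler_wpM2l (normr_ge0 C) h).
by rewrite ler_wpM2r ?ler_norm// addr_ge0.
Qed.

Lemma weight_shift v k (u : R) :
  weight (v + u *: delta_mx k ord0) <= weight v * (1 + `|u|).
Proof.
have h : weight (v + u *: delta_mx k ord0) <= weight v + `|u|.
  rewrite /weight -addrA lerD2l (bigD1 k)//= [X in _ <= X + _](bigD1 k)//=.
  rewrite !mxE !eqxx mulr1 addrAC; apply: lerD; first exact: ler_normD.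
  apply: ler_sum => j jk; rewrite !mxE (negbTE jk) /= mulr0 addr0//.
by apply: le_trans h _; rewrite mulrDr mulr1 lerD2l ler_peMl// weight_ge1.
Qed.

Lemma coord_measurable_coord k : coord_measurable (fun v => v k ord0).
Proof. by move=> d S V mV; exact: mV. Qed.

End growth.

Section gaussian_vector_ibp.
Context {R : realType} {d : measure_display} {T : measurableType d}
  (P : probability T R) {m : nat} (W : 'I_m -> T -> R).
Local Notation N := (normal_prob (0 : R) 1).
Local Notation RR := (measurableTypeR R).
Hypothesis gW : gaussian_family P W.

Definition vec (w : T) : 'cV[R]_m := \col_k W k w.

Lemma gaussian_family_marginal k (A : set R) : measurable A ->
  P (W k @^-1` A) = N A.
Proof.
move=> mA; have [mW gWB] := gW.
have fN (C : set R) : measurable C -> N C \is a fin_num.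
  by move=> mC; exact: (@fin_num_measure _ _ _ N).
have -> : W k @^-1` A = [set w | forall j, (if j == k then A else setT) (W j w)].
  apply/seteqP; split => w /=; first by move=> h j; case: eqP => [->|].
  by move=> /(_ k); rewrite eqxx.
rewrite (gWB (fun j => if j == k then A else setT)); last by move=> j; case: eqP.
rewrite (bigD1 k)//= eqxx big1 ?mulr1 ?fineK ?fN// => j /negbTE ->.
by rewrite [X in fine X](_ : _ = 1%E)//; exact: (@probability_setT _ _ _ N).
Qed.

Lemma integrable_coord_pow4 k :
  P.-integrable setT (fun w => ((1 + `|W k w|) ^+ 4)%:E).
Proof.
have [mW _] := gW.
have mWk : measurable_fun setT (W k : T -> RR) by exact: mW.
have m4 : measurable_fun setT (fun x : R => (1 + `|x|) ^+ 4).
  by apply: measurable_funX; apply: measurable_funD.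
have m4W : measurable_fun setT (fun w => (1 + `|W k w|) ^+ 4).
  by apply: (measurableT_comp m4); exact: mW.
apply/integrableP; split; first exact/measurable_EFinP.
have /integrableP[_] := @integrable_pow4_std_normal R.
apply: le_lt_trans.
rewrite -(@ge0_integral_pushforward _ _ _ _ _ _ mWk P setT
  (fun x : R => `|((1 + `|x|) ^+ 4)%:E|)%E)//.
  rewrite le_eqVlt; apply/orP; left; apply/eqP.
  by apply: eq_measure_integral => A mA _; exact: gaussian_family_marginal.
by apply: measurableT_comp => //; exact/measurable_EFinP.
Qed.

Lemma integrable_weight4 : P.-integrable setT (fun w => (weight (vec w) ^+ 4)%:E).
Proof.
have [mW _] := gW.
have pow4D (x y : R) : 0 <= x -> 0 <= y -> (x + y) ^+ 4 <= 8 * (x ^+ 4 + y ^+ 4).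
  move=> x0 y0; have h1 : (x + y) ^+ 2 <= 2 * (x ^+ 2 + y ^+ 2).
    by have := sqr_ge0 (x - y); nra.
  rewrite (_ : (x + y) ^+ 4 = ((x + y) ^+ 2) ^+ 2); last by rewrite -exprM.
  apply: (@le_trans _ _ ((2 * (x ^+ 2 + y ^+ 2)) ^+ 2)).
    by rewrite lerXn2r// ?nnegrE ?sqr_ge0// mulr_ge0// addr_ge0// sqr_ge0.
  by have := sqr_ge0 (x ^+ 2 - y ^+ 2); nra.
have sum4 (s : seq 'I_m) : exists2 C : R, 0 <= C & forall x : 'I_m -> R, (forall k, 0 <= x k) ->
    (1 + \sum_(k <- s) x k) ^+ 4 <= C * (1 + \sum_(k <- s) x k ^+ 4).
  elim: s => [|k s [C C0 IH]].
    by exists 1 => // x _; rewrite !big_nil addr0 expr1n mulr1.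
  exists (8 * C + 8) => [|x x0]; first by rewrite addr_ge0// mulr_ge0.
  rewrite !big_cons addrCA.
  have s0 : 0 <= 1 + \sum_(j <- s) x j by rewrite addr_ge0// sumr_ge0.
  have s40 : 0 <= \sum_(j <- s) x j ^+ 4 by rewrite sumr_ge0// => j _; rewrite exprn_ge0.
  have := pow4D _ _ (x0 k) s0; have := IH x x0; have := exprn_ge0 4 (x0 k).
  nra.
have [C C0 HC] := sum4 (index_enum 'I_m).
apply: (@le_integrable _ _ _ P _ measurableT _
  (fun w => C%:E * (1%:E + \sum_(k <- index_enum 'I_m) ((1 + `|W k w|) ^+ 4)%:E))%E).
- apply/measurable_EFinP; apply: measurable_funX; apply: measurable_funD => //.
  apply: measurable_sum => k; apply: measurableT_comp => //.
  by under eq_fun do rewrite mxE; exact: mW.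
- move=> w _; rewrite sumEFin -EFinD -EFinM !abse_EFin lee_fin.
  rewrite ger0_norm ?exprn_ge0 ?weight_ge0//; apply: le_trans (ler_norm _).
  have := HC (fun k => `|W k w|) (fun k => normr_ge0 _).
  rewrite {1}/weight; under [in X in _ -> X]eq_bigr do rewrite mxE.
  move=> h; apply: le_trans h _; rewrite ler_wpM2l// lerD2l.
  apply: ler_sum => k _; rewrite lerXn2r ?nnegrE ?addr_ge0//.
  by rewrite lerDr.
- apply: integrableZl => //; apply: integrableD => //.
    exact: finite_measure_integrable_cst.
  by apply: integrable_sum => // k _; exact: integrable_coord_pow4.
Qed.

Lemma integrable_poly_growth4 (F : 'cV[R]_m -> R) :
  coord_measurable F -> poly_growth 4 F -> P.-integrable setT (fun w => (F (vec w))%:E).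
Proof.
move=> mF [K FK]; have [mW _] := gW.
apply: (@le_integrable _ _ _ P _ measurableT _
  (fun w => K%:E * (weight (vec w) ^+ 4)%:E)%E).
- apply/measurable_EFinP; apply: mF => k.
  by under eq_fun do rewrite mxE; exact: mW.
- move=> w _; rewrite -EFinM !abse_EFin lee_fin.
  exact: le_trans (FK _) (ler_norm _).
- by apply: integrableZl => //; exact: integrable_weight4.
Qed.

(** Conditionally on the other coordinates, W k is standard normal and
    G(W) is a function of it alone. *)
Lemma gaussian_vector_ibp (k : 'I_m) (G dG : 'cV[R]_m -> R) :
  coord_measurable G -> coord_measurable dG ->
  (forall v (u : R), is_derive u 1 (fun s => G (v + s *: delta_mx k ord0))
     (dG (v + u *: delta_mx k ord0))) ->
  (forall v, continuous (fun s : R => dG (v + s *: delta_mx k ord0))) ->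
  poly_growth 4 (fun v => v k ord0 * G v) -> poly_growth 4 dG ->
  \int[P]_w (vec w k ord0 * G (vec w)) = \int[P]_w dG (vec w).
Proof.
move=> mG mdG dGE cdG gG gdG.
have [mY indY] := gaussian_coordinate_indep k gW.
set Y := fun w => _ in mY indY.
(* setV u y puts u back at the index k, where y holds the default 0. *)
pose setV (u : R) (y : m.-tuple R) : 'cV[R]_m := \col_j (if j == k then u else tnth y j).
have setVE u y : setV u y = setV 0 y + u *: delta_mx k ord0.
  apply/matrixP => i j; rewrite !mxE (ord1 j) eqxx andbT.
  by case: eqP => _; rewrite ?mulr1 ?mulr0 ?add0r ?addr0.
have vecE w : vec w = setV (W k w) (Y w).
  apply/matrixP => i j; rewrite !mxE tnth_mktuple.
  by case: eqP => [->|].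
have mset (F : 'cV[R]_m -> R) : coord_measurable F ->
    measurable_fun setT (fun z : RR * m.-tuple R => F (setV z.1 z.2)).
  move=> mF; apply: mF => j; rewrite /setV.
  under eq_fun do rewrite mxE.
  case: (j == k); first exact: measurable_fst.
  exact: (measurableT_comp (@measurable_tnth _ R m j)
    (@measurable_snd _ _ RR (m.-tuple R))).
have [mW _] := gW.
transitivity (\int[P]_w (W k w * G (setV (W k w) (Y w)))).
  by apply: eq_Rintegral => w _; rewrite -vecE mxE.
transitivity (\int[P]_w (dG (setV (W k w) (Y w)))); last first.
  by apply: eq_Rintegral => w _; rewrite -vecE.
apply: (indep_std_normal_ibp (P := P) (X := W k) (Y := Y) _ _ _
  (g := fun z => G (setV z.1 z.2)) (dg := fun z => dG (setV z.1 z.2))) => //=.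
- exact: mW.
- exact: mset.
- exact: mset.
- have mkG : coord_measurable (fun v : 'cV[R]_m => v k ord0 * G v).
    move=> d1 S V mV; apply: measurable_funM; [exact: mV|exact: mG].
  have := integrable_poly_growth4 mkG gG; apply: eq_integrable => // w _.
  by rewrite -vecE mxE.
- have := integrable_poly_growth4 mdG gdG; apply: eq_integrable => // w _.
  by rewrite -vecE.
- move=> y x; rewrite (setVE x).
  have -> : (fun u => G (setV u y)) = (fun u => G (setV 0 y + u *: delta_mx k ord0)).
    by apply/funext => u; rewrite setVE.
  exact: dGE.
- move=> y.
  have -> : (fun u => dG (setV u y)) = (fun u => dG (setV 0 y + u *: delta_mx k ord0)).
    by apply/funext => u; rewrite setVE.
  exact: cdG.
- move=> y; have [K1 K10 h1] := poly_growth_pos gG; have [K2 K20 h2] := poly_growth_pos gdG.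
  pose A := weight (setV 0 y) ^+ 4.
  have wle (x : R) : weight (setV x y) ^+ 4 <= A * (1 + `|x|) ^+ 4.
    rewrite setVE /A -exprMn lerXn2r ?nnegrE ?weight_ge0 ?weight_shift//.
    by rewrite mulr_ge0 ?weight_ge0 ?addr_ge0.
  have A0 : 0 <= A by rewrite exprn_ge0// weight_ge0.
  have p4 (x : R) : 0 <= (1 + `|x|) ^+ 4 by rewrite exprn_ge0// addr_ge0.
  exists ((K1 + K2) * A) => x; split.
    have := h1 (setV x y); rewrite {1}/setV mxE eqxx => h.
    apply: le_trans h _; rewrite -mulrA; apply: ler_pM => //.
      by rewrite exprn_ge0// weight_ge0.
    by rewrite lerDl.
  apply: le_trans (h2 _) _; rewrite -mulrA; apply: ler_pM => //.
    by rewrite exprn_ge0// weight_ge0.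
  by rewrite lerDr.
Qed.

End gaussian_vector_ibp.

(** * The Stein identity for quadratic polynomials *)

Section quadratic_polynomial.
Context {R : realType} {m : nat}.
Implicit Types (a v : 'cV[R]_m) (B : 'M[R]_m).

Definition dotv a v : R := (a^T *m v) ord0 ord0.

Definition quadpoly (c : R) a B v : R := c + dotv a v + quadform B v.

Lemma dotvE a v : dotv a v = \sum_k a k ord0 * v k ord0.
Proof. by rewrite /dotv mxE; apply: eq_bigr => k _; rewrite mxE. Qed.

Lemma dotvC a v : dotv a v = dotv v a.
Proof. by rewrite !dotvE; apply: eq_bigr => k _; rewrite mulrC. Qed.

Lemma dotvDr a v1 v2 : dotv a (v1 + v2) = dotv a v1 + dotv a v2.
Proof. by rewrite /dotv mulmxDr mxE. Qed.

Lemma dotvDl a v1 v2 : dotv (v1 + v2) a = dotv v1 a + dotv v2 a.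
Proof. by rewrite !(dotvC _ a) dotvDr. Qed.

Lemma dotvZr a (u : R) v : dotv a (u *: v) = u * dotv a v.
Proof. by rewrite /dotv -scalemxAr mxE. Qed.

Lemma dotvZl a (u : R) v : dotv (u *: v) a = u * dotv v a.
Proof. by rewrite !(dotvC _ a) dotvZr. Qed.

Lemma dotv_delta a (k : 'I_m) : dotv a (delta_mx k ord0) = a k ord0.
Proof.
rewrite dotvE (bigD1 k)//= mxE !eqxx mulr1 big1 ?addr0// => j /negbTE jk.
by rewrite mxE jk /= mulr0.
Qed.

Lemma mulmx_delta B (k i : 'I_m) :
  (B *m (delta_mx k ord0 : 'cV[R]_m)) i ord0 = B i k.
Proof.
rewrite mxE (bigD1 k)//= mxE !eqxx mulr1 big1 ?addr0// => j /negbTE jk.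
by rewrite mxE jk /= mulr0.
Qed.

Lemma quadformE B v : quadform B v = dotv v (B *m v).
Proof. by rewrite /quadform /dotv mulmxA. Qed.

Lemma dotv_sym B a v : B^T = B -> dotv a (B *m v) = dotv (B *m a) v.
Proof. by move=> sB; rewrite /dotv trmx_mul sB mulmxA. Qed.

Lemma dotv_ge0 a : 0 <= dotv a a.
Proof. by rewrite dotvE sumr_ge0// => k _; rewrite -expr2 sqr_ge0. Qed.

Lemma quadpoly_shift c a B v (k : 'I_m) (u : R) : B^T = B ->
  quadpoly c a B (v + u *: delta_mx k ord0) =
  quadpoly c a B v + u * (a + 2 *: (B *m v)) k ord0 + u ^+ 2 * B k k.
Proof.
move=> sB; rewrite /quadpoly !quadformE mulmxDr -scalemxAr !(dotvDl, dotvDr, dotvZl, dotvZr).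
rewrite (dotv_sym v (delta_mx _ _) sB) !(dotvC (delta_mx _ _)) !dotv_delta.
by rewrite mulmx_delta !mxE; ring.
Qed.

Lemma mulmx_delta_coord B v (k : 'I_m) (u : R) :
  (B *m (v + u *: delta_mx k ord0)) k ord0 = (B *m v) k ord0 + u * B k k.
Proof. by rewrite mulmxDr -scalemxAr mxE [in X in _ + X]mxE mulmx_delta. Qed.

Lemma affine_growth a B (r : R) k : poly_growth 1 (fun v => (a + r *: (B *m v)) k ord0).
Proof.
have -> : (fun v => (a + r *: (B *m v)) k ord0) =
    (fun v => a k ord0 + \sum_j (r * B k j) * v j ord0).
  apply/funext => v; rewrite !mxE mulr_sumr; congr (_ + _).
  by apply: eq_bigr => j _; rewrite mulrA.
apply: poly_growthD; first exact: poly_growth_cst.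
apply: poly_growth_sum => j; apply: (@poly_growthM _ _ 0 1).
  exact: poly_growth_cst.
exact: poly_growth_coord.
Qed.

Lemma affine_measurable a B (r : R) k :
  coord_measurable (fun v => (a + r *: (B *m v)) k ord0).
Proof.
move=> d S V mV.
have -> : (fun s => (a + r *: (B *m V s)) k ord0) =
    (fun s => a k ord0 + \sum_j (r * B k j) * V s j ord0).
  apply/funext => v; rewrite !mxE mulr_sumr; congr (_ + _).
  by apply: eq_bigr => j _; rewrite mulrA.
apply: measurable_funD => //; apply: measurable_sum => j.
by apply: measurable_funM => //; exact: mV.
Qed.

Lemma quadpolyE c a B v :
  quadpoly c a B v = c + \sum_k v k ord0 * (a + 1 *: (B *m v)) k ord0.
Proof.
rewrite /quadpoly -addrA; congr (_ + _).
rewrite quadformE (dotvC a) -dotvDr dotvE; apply: eq_bigr => k _.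
by rewrite scale1r.
Qed.

Lemma quadpoly_growth c a B : poly_growth 2 (quadpoly c a B).
Proof.
rewrite (_ : quadpoly c a B = (fun v => c + \sum_k v k ord0 * (a + 1 *: (B *m v)) k ord0)).
  apply: poly_growthD; first exact: poly_growth_cst.
  apply: poly_growth_sum => k; apply: (@poly_growthM _ _ 1 1).
    exact: poly_growth_coord.
  exact: affine_growth.
by apply/funext => v; rewrite quadpolyE.
Qed.

Lemma quadpoly_measurable c a B : coord_measurable (quadpoly c a B).
Proof.
move=> d S V mV.
rewrite (_ : (fun s => _) = (fun s => c + \sum_k V s k ord0 * (a + 1 *: (B *m V s)) k ord0)).
  apply: measurable_funD => //; apply: measurable_sum => k.
  by apply: measurable_funM; [exact: mV|exact: affine_measurable].
by apply/funext => s; rewrite quadpolyE.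
Qed.

(** Summing over k the affine factor of Q(v) = c + sum_k v_k (a + B v)_k times
    the partial derivative (a + 2 B v)_k gives the factor Gamma of the Stein
    identity; that it is again a quadratic polynomial makes the method close up. *)
Lemma stein_factorE a B v : B^T = B ->
  \sum_k (a + 1 *: (B *m v)) k ord0 * (a + 2 *: (B *m v)) k ord0 =
  quadpoly (dotv a a) (3 *: (B *m a)) (2 *: (B *m B)) v.
Proof.
move=> sB; rewrite -dotvE scale1r /quadpoly quadformE.
rewrite !(dotvDl, dotvDr, dotvZr, dotvZl) -scalemxAl dotvZr -mulmxA.
rewrite (dotv_sym v (B *m v) sB) (dotv_sym a v sB) (dotvC (B *m v) a) (dotv_sym a v sB).
by ring.
Qed.

End quadratic_polynomial.

Section stein_identity.
Context {R : realType} {d : measure_display} {T : measurableType d}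
  (P : probability T R).

Lemma linear_growth_of_bounded_derivative (f df : R -> R) (C : R) :
  (forall x : R, is_derive x 1 f (df x)) -> (forall x, `|df x| <= C) ->
  forall s, `|f s| <= (`|f 0| + C) * (1 + `|s|).
Proof.
move=> dfE dfC s.
have C0 : 0 <= C by exact: le_trans (dfC 0).
have lip : `|f s - f 0| <= C * `|s|.
  have cf := is_derive_continuous dfE.
  have mvt (x y : R) : x <= y -> `|f y - f x| <= C * (y - x).
    move=> xy; have [c _ ->] := MVT_segment xy (fun z _ => dfE z) (continuous_subspaceT cf).
    by rewrite normrM ler_pM// ger0_norm ?subr_ge0.
  have [s0|/ltW s0] := leP 0 s.
    by have := mvt _ _ s0; rewrite subr0 (ger0_norm s0).
  by have := mvt _ _ s0; rewrite distrC sub0r (ler0_norm s0).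
have := ler_distD (f 0) (f s) 0; rewrite !subr0 => h.
apply: le_trans h _; apply: le_trans (lerD lip (lexx _)) _.
have := normr_ge0 (f 0); have := normr_ge0 s; nra.
Qed.

Lemma Rintegral_sum (I : Type) (s : seq I) (F : I -> T -> R) :
  (forall i, P.-integrable setT (EFin \o F i)) ->
  \int[P]_w (\sum_(i <- s) F i w) = \sum_(i <- s) \int[P]_w F i w.
Proof.
move=> iF; elim: s => [|i s IH].
  rewrite big_nil; under eq_Rintegral do rewrite big_nil.
  by rewrite Rintegral_cst// mul0r.
rewrite big_cons -IH -RintegralD//.
  by apply: eq_Rintegral => w _; rewrite big_cons.
have := integrable_sum measurableT s (fun i (_ : true) => iF i).
by apply: eq_integrable => // w _; rewrite /= sumEFin.
Qed.

Context {m : nat} (W : 'I_m -> T -> R).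
Hypothesis gW : gaussian_family P W.
Implicit Types (a v : 'cV[R]_m) (B : 'M[R]_m).

(** Write Q(v) - c = sum_k v_k (a + B v)_k and integrate each
    v_k (a + B v)_k f(Q) by parts in v_k. The derivative of (a + B v)_k
    contributes B_kk f(Q), in total (tr B) f(Q), and that of f(Q) contributes
    (a + B v)_k (a + 2 B v)_k f'(Q). *)
Lemma stein_quadpoly c a B (f df : R -> R) (C : R) : B^T = B ->
  (forall x : R, is_derive x 1 f (df x)) -> continuous df ->
  (forall x, `|df x| <= C) ->
  let Q v := quadpoly c a B v in
  let Gam v := quadpoly (dotv a a) (3 *: (B *m a)) (2 *: (B *m B)) v in
  \int[P]_w ((Q (vec W w) - (c + \tr B)) * f (Q (vec W w))) =
  \int[P]_w (Gam (vec W w) * df (Q (vec W w))).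
Proof.
move=> sB dfE cdf dfC Q Gam.
have cf := is_derive_continuous dfE.
have mf := continuous_measurable_fun cf.
have mdf := continuous_measurable_fun cdf.
have fgrow := linear_growth_of_bounded_derivative dfE dfC.
pose l (r : R) k v := (a + r *: (B *m v)) k ord0.
have mQ := quadpoly_measurable c a B.
have mfQ : coord_measurable (fun v => f (Q v)).
  by move=> d1 S V mV; apply: (measurableT_comp mf); exact: mQ.
have mdfQ : coord_measurable (fun v => df (Q v)).
  by move=> d1 S V mV; apply: (measurableT_comp mdf); exact: mQ.
have gfQ : poly_growth 2 (fun v => f (Q v)).
  exact: poly_growth_comp fgrow (quadpoly_growth c a B).
have gdfQ : poly_growth 0 (fun v => df (Q v)).
  by exists C => v; rewrite expr0 mulr1.
pose G k v := l 1 k v * f (Q v).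
pose dG k v := B k k * f (Q v) + l 1 k v * l 2 k v * df (Q v).
have mM (F1 F2 : 'cV[R]_m -> R) : coord_measurable F1 -> coord_measurable F2 ->
    coord_measurable (fun v => F1 v * F2 v).
  by move=> m1 m2 d1 S V mV; apply: measurable_funM; [exact: m1|exact: m2].
have mG k : coord_measurable (G k) by apply: (mM) => //; exact: affine_measurable.
have mll k : coord_measurable (fun v => l 1 k v * l 2 k v * df (Q v)).
  by apply: (mM) => //; apply: (mM); exact: affine_measurable.
have mBf k : coord_measurable (fun v => B k k * f (Q v)).
  by move=> d1 S V mV; apply: measurable_funM => //; exact: mfQ.
have mdG k : coord_measurable (dG k).
  by move=> d1 S V mV; apply: measurable_funD; [exact: mBf|exact: mll].
have gvG k : poly_growth 4 (fun v => v k ord0 * G k v).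
  apply: (@poly_growthM _ _ 1 3); first exact: poly_growth_coord.
  by apply: (@poly_growthM _ _ 1 2) => //; exact: affine_growth.
have gll k : poly_growth 4 (fun v => l 1 k v * l 2 k v * df (Q v)).
  apply: (@poly_growthW _ _ 2) => //; apply: (@poly_growthM _ _ 2 0) => //.
  by apply: (@poly_growthM _ _ 1 1); exact: affine_growth.
have gBf k : poly_growth 4 (fun v => B k k * f (Q v)).
  apply: (@poly_growthW _ _ 2) => //; apply: (@poly_growthM _ _ 0 2) => //.
  exact: poly_growth_cst.
have gdG k : poly_growth 4 (dG k) by exact: poly_growthD.
have line_derive k v (u : R) : is_derive u 1
    (fun s => Q (v + s *: delta_mx k ord0)) (l 2 k (v + u *: delta_mx k ord0)).
  have -> : (fun s => Q (v + s *: delta_mx k ord0)) =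
      (fun s => Q v + s * l 2 k v + s ^+ 2 * B k k).
    by apply/funext => s; rewrite /Q quadpoly_shift.
  apply: is_derive_eq.
  rewrite /GRing.scale /= /l [RHS]mxE [in RHS]mxE mulmx_delta_coord !mxE.
  ring.
have line_l k v (u r : R) : l r k (v + u *: delta_mx k ord0) = l r k v + u * (r * B k k).
  by rewrite /l [LHS]mxE [in LHS]mxE mulmx_delta_coord !mxE; ring.
have ibp k : \int[P]_w (vec W w k ord0 * G k (vec W w)) = \int[P]_w dG k (vec W w).
  apply: (gaussian_vector_ibp gW) => //.
  - move=> v u; set e := delta_mx k ord0.
    have d1 : is_derive u 1 (fun s => l 1 k (v + s *: e)) (B k k).
      have -> : (fun s => l 1 k (v + s *: e)) = (fun s => l 1 k v + s * (1 * B k k)).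
        by apply/funext => s; exact: line_l.
      by apply: is_derive_eq; rewrite /GRing.scale /=; ring.
    have d2 := is_derive1_comp (dfE _) (line_derive k v u).
    have d3 := is_deriveM d1 d2.
    apply: is_derive_eq; rewrite /dG /GRing.scale /=; ring.
  - move=> v; set e := delta_mx k ord0.
    have cl (r : R) : continuous (fun s : R => l r k (v + s *: e)).
      have -> : (fun s => l r k (v + s *: e)) = (fun s => l r k v + s * (r * B k k)).
        by apply/funext => s; exact: line_l.
      by move=> s; apply: cvgD; [exact: cvg_cst|apply: cvgM; [exact: cvg_id|exact: cvg_cst]].
    have cQ := is_derive_continuous (line_derive k v).
    move=> s; apply: cvgD.
      by apply: cvgM; [exact: cvg_cst|apply: (continuous_comp (cQ s)); exact: cf].
    apply: cvgM; last by apply: (continuous_comp (cQ s)); exact: cdf.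
    by apply: cvgM; exact: cl.
have intm (F : 'cV[R]_m -> R) : coord_measurable F -> poly_growth 4 F ->
    P.-integrable setT (fun w => (F (vec W w))%:E).
  exact: (integrable_poly_growth4 gW).
have mvG k : coord_measurable (fun v => v k ord0 * G k v).
  by apply: (mM) => //; exact: coord_measurable_coord.
have sumL : \int[P]_w (\sum_k vec W w k ord0 * G k (vec W w)) =
    \int[P]_w (\sum_k dG k (vec W w)).
  rewrite !Rintegral_sum; first by apply: eq_bigr => k _; exact: ibp.
    by move=> k; exact: intm (mdG k) (gdG k).
  by move=> k; exact: intm (mvG k) (gvG k).
have LE w : \sum_k vec W w k ord0 * G k (vec W w) =
    (Q (vec W w) - c) * f (Q (vec W w)).
  rewrite /Q [in X in X * _]quadpolyE [_ + \sum_k _]addrC addrK mulr_suml.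
  by apply: eq_bigr => k _; rewrite mulrA.
have RE w : \sum_k dG k (vec W w) =
    \tr B * f (Q (vec W w)) + Gam (vec W w) * df (Q (vec W w)).
  rewrite big_split /= -mulr_suml; congr (_ + _).
  by rewrite -mulr_suml /Gam -stein_factorE.
have gf4 : poly_growth 4 (fun v => f (Q v)) by exact: poly_growthW gfQ.
have itr : P.-integrable setT (fun w => (\tr B * f (Q (vec W w)))%:E).
  have := integrableZl measurableT (\tr B) (intm _ mfQ gf4).
  by apply: eq_integrable => // w _; rewrite EFinM.
have mQf : coord_measurable (fun v => (Q v - c) * f (Q v)).
  apply: (mM) => // d1 S V mV; apply: measurable_funB => //; exact: mQ.
have gQf : poly_growth 4 (fun v => (Q v - c) * f (Q v)).
  apply: (@poly_growthM _ _ 2 2) => //; apply: poly_growthD.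
    exact: quadpoly_growth.
  exact: poly_growth_cst.
have mGdf : coord_measurable (fun v => Gam v * df (Q v)).
  by apply: (mM) => //; exact: quadpoly_measurable.
have gGdf : poly_growth 4 (fun v => Gam v * df (Q v)).
  apply: (@poly_growthW _ _ 2) => //; apply: (@poly_growthM _ _ 2 0) => //.
  exact: quadpoly_growth.
have iQf := intm _ mQf gQf; have iG := intm _ mGdf gGdf.
transitivity (\int[P]_w ((Q (vec W w) - c) * f (Q (vec W w)) - \tr B * f (Q (vec W w)))).
  by apply: eq_Rintegral => w _; ring.
rewrite RintegralB//.
move: sumL; under eq_Rintegral do rewrite LE.
under [X in _ = X -> _]eq_Rintegral do rewrite RE.
by rewrite RintegralD// => ->; rewrite addrAC subrr add0r.
Qed.

Lemma integrable_quadpoly2 c1 a1 B1 c2 a2 B2 :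
  P.-integrable setT
    (fun w => (quadpoly c1 a1 B1 (vec W w) * quadpoly c2 a2 B2 (vec W w))%:E).
Proof.
apply: (integrable_poly_growth4 gW (F := fun v => quadpoly c1 a1 B1 v * quadpoly c2 a2 B2 v)).
  by move=> d1 S V mV; apply: measurable_funM; exact: quadpoly_measurable.
by apply: (@poly_growthM _ _ 2 2); exact: quadpoly_growth.
Qed.

Lemma integrable_quadpoly c a B :
  P.-integrable setT (fun w => (quadpoly c a B (vec W w))%:E).
Proof.
apply: (integrable_poly_growth4 gW (quadpoly_measurable c a B)).
exact: (poly_growthW _ (quadpoly_growth _ _ _)).
Qed.

(** The Stein identity with f = 1. *)
Lemma quadpoly_mean c a B : B^T = B ->
  \int[P]_w quadpoly c a B (vec W w) = c + \tr B.
Proof.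
move=> sB.
have d1 (x : R) : is_derive x 1 (fun _ : R => 1 : R) 0 by exact: is_derive_cst.
have c0 : continuous (fun _ : R => 0 : R) by move=> x; exact: cvg_cst.
have b0 (x : R) : `|0 : R| <= 0 by rewrite normr0.
have := stein_quadpoly c a sB d1 c0 b0 => /=.
under eq_Rintegral do rewrite mulr1.
under [in X in _ = X -> _]eq_Rintegral do rewrite mulr0.
rewrite Rintegral_cst// mul0r RintegralB//.
- rewrite Rintegral_cst// (_ : fine (P setT) = 1) ?mulr1; last by rewrite probability_setT.
  by move/eqP; rewrite subr_eq0 => /eqP.
- exact: integrable_quadpoly.
- exact: finite_measure_integrable_cst.
Qed.

(** The Stein identity with f(s) = s - E Q, whose right-hand side is E Gamma. *)
Lemma quadpoly_variance c a B : B^T = B ->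
  \int[P]_w ((quadpoly c a B (vec W w) - (c + \tr B)) ^+ 2) =
  dotv a a + 2 * \tr (B *m B).
Proof.
move=> sB.
have d1 (x : R) : is_derive x 1 (fun s : R => s - (c + \tr B)) 1.
  by apply: is_derive_eq; rewrite subr0.
have c0 : continuous (fun _ : R => 1 : R) by move=> x; exact: cvg_cst.
have b0 (x : R) : `|1 : R| <= 1 by rewrite normr1.
have /= := stein_quadpoly c a sB d1 c0 b0.
under eq_Rintegral do rewrite -expr2.
move=> ->; under eq_Rintegral do rewrite mulr1.
rewrite quadpoly_mean; first by rewrite mxtraceZ.
by rewrite linearZ /= trmx_mul sB.
Qed.

End stein_identity.

(** * The central limit theorem for quadratic polynomials *)

Section gaussian_limit.
Context {R : realType}.
Local Notation N := (normal_prob (0 : R) 1).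

(** With f the solution of the Stein equation, E h(Q) - E h(N(0,1)) equals
    E[f'(Q) (1 - Gamma)] - M E f(Q). Here S = E Gamma and V = Var Gamma; the free
    parameter eta enters through |y| <= eta + y^2 / eta for y = Gamma - S, which
    turns the variance into a bound on E |y|. The term in M, the mean
    of Q, is bounded by the linear growth of f and the second moment S + M^2.
    The constant depends on h alone, hence the bound is uniform in the dimension. *)
Lemma quadpoly_stein_bound (h : R -> R) (K : R) :
  continuous h -> (forall x, `|h x| <= K) ->
  exists2 C : R, 0 <= C &
  forall (d : measure_display) (T : measurableType d) (P : probability T R)
    (m : nat) (W : 'I_m -> T -> R) (c : R) (a : 'cV[R]_m) (B : 'M[R]_m) (eta : R),
  gaussian_family P W -> B^T = B -> 0 < eta ->
  let M := c + \tr B in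
  let S := dotv a a + 2 * \tr (B *m B) in
  let V := 9 * dotv (B *m a) (B *m a) + 8 * \tr (B *m B *m (B *m B)) in
  `|\int[P]_w h (quadpoly c a B (vec W w)) - \int[N]_u h u| <=
  C * (`|1 - S| + eta + V / eta + `|M| * (2 + S + M ^+ 2)).
Proof.
move=> ch hK.
have [f [df [dfE cdf [C0 dfC] steinE]]] := stein_equation_solution ch hK.
have C00 : 0 <= C0 by exact: le_trans (dfC 0).
have cf := is_derive_continuous dfE.
have mf := continuous_measurable_fun cf.
have mdf := continuous_measurable_fun cdf.
have fgrow := linear_growth_of_bounded_derivative dfE dfC.
exists (`|f 0| + C0); first by rewrite addr_ge0.
move=> d T P m W c a B eta gW sB eta0; cbv zeta.
set M := c + \tr B; set S := dotv a a + 2 * \tr (B *m B).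
set V := 9 * dotv (B *m a) (B *m a) + 8 * \tr (B *m B *m (B *m B)).
set C := `|f 0| + C0.
have C0C : C0 <= C by rewrite /C lerDr.
have C_ge0 : 0 <= C by rewrite addr_ge0.
pose Q w := quadpoly c a B (vec W w).
pose Gam w := quadpoly (dotv a a) (3 *: (B *m a)) (2 *: (B *m B)) (vec W w).
have s2 : (2 *: (B *m B))^T = 2 *: (B *m B) by rewrite linearZ /= trmx_mul sB.
have mW := gW.1.
have mvec k : measurable_fun setT (fun w => vec W w k ord0).
  by under eq_fun do rewrite mxE; exact: mW.
have mQ : measurable_fun setT Q by exact: quadpoly_measurable.
have mG : measurable_fun setT Gam by exact: quadpoly_measurable.
have iQ : P.-integrable setT (EFin \o Q) by exact: integrable_quadpoly.
have iG : P.-integrable setT (EFin \o Gam) by exact: integrable_quadpoly.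
have iG2 : P.-integrable setT (EFin \o (fun w => (Gam w - S) ^+ 2)).
  have := integrable_quadpoly2 gW (dotv a a - S) (3 *: (B *m a)) (2 *: (B *m B))
     (dotv a a - S) (3 *: (B *m a)) (2 *: (B *m B)).
  by apply: eq_integrable => // w _; congr EFin; rewrite /= /Gam /quadpoly; ring.
have iQ2 : P.-integrable setT (EFin \o (fun w => (Q w) ^+ 2)).
  have := integrable_quadpoly2 gW c a B c a B.
  by apply: eq_integrable => // w _.
have icst (r : R) : P.-integrable setT (EFin \o (fun _ : T => r)).
  exact: finite_measure_integrable_cst.
have Rcst (r : R) : \int[P]_w r = r.
  by rewrite Rintegral_cst// (_ : fine (P setT) = 1) ?mulr1// probability_setT.
have le_int (F1 F2 : T -> R) : measurable_fun setT F1 ->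
    P.-integrable setT (EFin \o F2) -> (forall w, `|F1 w| <= F2 w) ->
    P.-integrable setT (EFin \o F1) /\ `|\int[P]_w F1 w| <= \int[P]_w F2 w.
  move=> m1 i2 F12.
  have i1 : P.-integrable setT (EFin \o F1).
    apply: le_integrable i2 => //; first exact/measurable_EFinP.
    by move=> w _ /=; rewrite lee_fin; apply: le_trans (F12 w) (ler_norm _).
  split=> //; apply: le_trans (le_normr_Rintegral _ i1) _ => //.
  by apply: le_Rintegral => //; exact: integrable_norm.
have mdfQ : measurable_fun setT (fun w => df (Q w)) by exact: measurableT_comp mdf mQ.
have mfQ : measurable_fun setT (fun w => f (Q w)) by exact: measurableT_comp mf mQ.
have EQ : \int[P]_w Q w = M by exact: quadpoly_mean.
have VG : \int[P]_w ((Gam w - S) ^+ 2) = V.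
  have := quadpoly_variance gW (dotv a a) (3 *: (B *m a)) s2.
  rewrite mxtraceZ -/S => ->.
  rewrite dotvZl dotvZr -!scalemxAl -!scalemxAr !mxtraceZ /V.
  ring.
have EQ2 : \int[P]_w ((Q w) ^+ 2) = S + M ^+ 2.
  have := quadpoly_variance gW c a sB; rewrite -/M -/S => <-.
  have iQM : P.-integrable setT (EFin \o (fun w => 2 * M * Q w)).
    have := integrableZl measurableT (2 * M) iQ.
    by apply: eq_integrable => // w _; rewrite EFinM.
  transitivity (\int[P]_w ((quadpoly c a B (vec W w) - M) ^+ 2 + (2 * M * Q w - M ^+ 2))).
    by apply: eq_Rintegral => w _; rewrite -/(Q w); ring.
  have iA : P.-integrable setT (EFin \o (fun w => 2 * M * Q w - M ^+ 2)).
    have := integrableB measurableT iQM (icst (M ^+ 2)).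
    by apply: eq_integrable => // w _.
  rewrite RintegralD//.
    rewrite RintegralB// RintegralZl// EQ Rcst; congr (_ + _); ring.
  have := integrable_quadpoly2 gW (c - M) a B (c - M) a B.
  by apply: eq_integrable => // w _; congr EFin; rewrite /quadpoly; ring.
have [ih _] : P.-integrable setT (EFin \o (fun w => h (Q w))) /\
    `|\int[P]_w h (Q w)| <= \int[P]_w K.
  apply: (le_int) => //.
  by apply: measurableT_comp mQ; exact: continuous_measurable_fun.
(* |f(q)| <= C (1 + |q|) <= C (2 + q^2) *)
have [ifQ bfQ] : P.-integrable setT (EFin \o (fun w => f (Q w))) /\
    `|\int[P]_w f (Q w)| <= \int[P]_w (C * (2 + Q w ^+ 2)).
  apply: (le_int) => //.
    have := integrableZl measurableT C (integrableD measurableT (icst 2) iQ2).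
    by apply: eq_integrable => // w _; rewrite EFinM EFinD.
  move=> w; apply: le_trans (fgrow _) _; rewrite ler_wpM2l//.
  rewrite (_ : 2 = 1 + 1 :> R); last by ring.
  rewrite -addrA lerD2l -(real_normK (num_real (Q w))).
  by have := sqr_ge0 (`|Q w| - 1); have := normr_ge0 (Q w); nra.
have bfQ' : `|\int[P]_w f (Q w)| <= C * (2 + S + M ^+ 2).
  apply: le_trans bfQ _; rewrite RintegralZl//.
    by rewrite RintegralD// Rcst EQ2 addrA.
  have := integrableD measurableT (icst 2) iQ2.
  by apply: eq_integrable => // w _; rewrite EFinD.
have imaj : P.-integrable setT (EFin \o (fun w => (`|1 - S| + eta) + (Gam w - S) ^+ 2 / eta)).
  have := integrableD measurableT (icst (`|1 - S| + eta)) (integrableZl measurableT eta^-1 iG2).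
  by apply: eq_integrable => // w _; rewrite /= -EFinM -EFinD mulrC.
have iGe : P.-integrable setT (EFin \o (fun w => (Gam w - S) ^+ 2 / eta)).
  have := integrableZl measurableT eta^-1 iG2.
  by apply: eq_integrable => // w _; rewrite /= -EFinM mulrC.
have [i1G b1G] : P.-integrable setT (EFin \o (fun w => df (Q w) * (1 - Gam w))) /\
    `|\int[P]_w (df (Q w) * (1 - Gam w))| <=
    \int[P]_w (C * ((`|1 - S| + eta) + (Gam w - S) ^+ 2 / eta)).
  apply: (le_int).
  - by apply: measurable_funM => //; apply: measurable_funB.
  - have := integrableZl measurableT C imaj.
    by apply: eq_integrable => // w _; rewrite EFinM.
  - move=> w; rewrite normrM; apply: ler_pM => //; first exact: le_trans (dfC _) C0C.
    rewrite (_ : 1 - Gam w = (1 - S) - (Gam w - S)); last by ring.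
    apply: le_trans (ler_normB _ _) _; rewrite -[leRHS]addrA lerD2l.
    rewrite -(real_normK (num_real (Gam w - S))).
    set y := `|_|; have y0 : 0 <= y by rewrite /y.
    rewrite -(ler_pM2r eta0) mulrDl divfK ?gt_eqF//.
    by have := sqr_ge0 (y - eta); nra.
have b1G' : `|\int[P]_w (df (Q w) * (1 - Gam w))| <= C * (`|1 - S| + eta + V / eta).
  apply: le_trans b1G _; rewrite RintegralZl// RintegralD// Rcst.
  by rewrite RintegralZr// VG.
have [idf _] : P.-integrable setT (EFin \o (fun w => df (Q w))) /\
    `|\int[P]_w df (Q w)| <= \int[P]_w C0.
  exact: (le_int).
have iGdf : P.-integrable setT (EFin \o (fun w => Gam w * df (Q w))).
  have := integrableB measurableT idf i1G.
  by apply: eq_integrable => // w _; rewrite /= -EFinB; congr EFin; ring.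
have iMf : P.-integrable setT (EFin \o (fun w => M * f (Q w))).
  have := integrableZl measurableT M ifQ.
  by apply: eq_integrable => // w _; rewrite EFinM.
have iQf : P.-integrable setT (EFin \o (fun w => (Q w - M) * f (Q w))).
  have : P.-integrable setT (EFin \o (fun w => df (Q w) - (h (Q w) - \int[N]_u h u) - M * f (Q w))).
    have := integrableB measurableT (integrableB measurableT idf
      (integrableB measurableT ih (icst (\int[N]_u h u)))) iMf.
    by apply: eq_integrable => // w _.
  apply: eq_integrable => // w _; congr EFin; rewrite /= -steinE; ring.
have st := stein_quadpoly gW c a sB dfE cdf dfC.
rewrite /= -/M in st.
have key : \int[P]_w h (Q w) - \int[N]_u h u =
    \int[P]_w (df (Q w) * (1 - Gam w)) - M * \int[P]_w f (Q w).
  have -> : \int[P]_w (df (Q w) * (1 - Gam w)) = \int[P]_w df (Q w) - \int[P]_w (Gam w * df (Q w)).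
    by rewrite -RintegralB//; apply: eq_Rintegral => w _; ring.
  rewrite -st -RintegralZl// -RintegralB//.
  rewrite -[X in _ - X]Rcst -!RintegralB//; last first.
    by have := integrableB measurableT idf iQf; apply: eq_integrable => // w _.
  by apply: eq_Rintegral => w _; rewrite -steinE -/(Q w); ring.
rewrite key; apply: le_trans (ler_normB _ _) _.
rewrite mulrDr; apply: lerD => //.
rewrite normrM [leRHS]mulrCA ler_wpM2l//.
Qed.

(** The bound tends to C eta, and eta is arbitrary. *)
Lemma quadpoly_cvg_std_normal (disp : nat -> measure_display)
    (T : forall d, measurableType (disp d)) (P : forall d, probability (T d) R)
    (m : nat -> nat) (W : forall d, 'I_(m d) -> T d -> R)
    (c : nat -> R) (a : forall d, 'cV[R]_(m d)) (B : forall d, 'M[R]_(m d))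
    (h : R -> R) (K : R) :
  (forall d, gaussian_family (P d) (W d)) -> (forall d, (B d)^T = B d) ->
  c d + \tr (B d) @[d --> \oo] --> (0 : R) ->
  dotv (a d) (a d) + 2 * \tr (B d *m B d) @[d --> \oo] --> (1 : R) ->
  dotv (B d *m a d) (B d *m a d) @[d --> \oo] --> (0 : R) ->
  \tr (B d *m B d *m (B d *m B d)) @[d --> \oo] --> (0 : R) ->
  continuous h -> (forall x, `|h x| <= K) ->
  \int[P d]_w h (quadpoly (c d) (a d) (B d) (vec (W d) w)) @[d --> \oo] -->
  \int[N]_u h u.
Proof.
move=> gW sB Mc Sc Bac Bc ch hK; have [C C0 bnd] := quadpoly_stein_bound ch hK.
apply/cvgrPdist_lt => e e0.
pose eta := e / (2 * (C + 1)).
have C1 : 0 < 2 * (C + 1) by rewrite mulr_gt0// ltr_wpDl.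
have eta0 : 0 < eta by rewrite divr_gt0.
have Ceta : C * eta < e.
  rewrite /eta mulrA ltr_pdivrMr// mulrC ltr_pM2l//; lra.
set b := fun d => C * (`|1 - (dotv (a d) (a d) + 2 * \tr (B d *m B d))| + eta +
   (9 * dotv (B d *m a d) (B d *m a d) + 8 * \tr (B d *m B d *m (B d *m B d))) / eta +
   `|c d + \tr (B d)| * (2 + (dotv (a d) (a d) + 2 * \tr (B d *m B d)) + (c d + \tr (B d)) ^+ 2)).
have bc : b d @[d --> \oo] --> C * (`|1 - 1 : R| + eta + (9 * 0 + 8 * 0) / eta + `|0 : R| * (2 + 1 + 0 ^+ 2)).
  apply: cvgMr; apply: cvgD; first (apply: cvgD; first apply: cvgD).
  - by apply: cvg_norm; apply: cvgB => //; exact: cvg_cst.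
  - exact: cvg_cst.
  - by apply: cvgMl; apply: cvgD; exact: cvgMr.
  - apply: cvgM; first exact: cvg_norm.
    apply: cvgD; first by apply: cvgD => //; exact: cvg_cst.
    by rewrite !expr2; under eq_fun do rewrite expr2; exact: cvgM.
move: bc; rewrite subrr normr0 !mulr0 addr0 !mul0r !addr0 add0r => bc.
near=> d; rewrite distrC; apply: le_lt_trans (bnd _ _ _ _ _ _ _ _ _ (gW d) (sB d) eta0) _.
by near: d; exact: (cvgr_lt _ bc).
Unshelve. all: by end_near. Qed.

Lemma eq_cvgn (f g : nat -> R) (l : R) : f =1 g ->
  g d @[d --> \oo] --> l -> f d @[d --> \oo] --> l.
Proof. by move=> /funext ->. Qed.

Lemma quadpoly_affine m (c : R) (a : 'cV[R]_m) (B : 'M[R]_m) (mu sigma : R) v :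
  sigma != 0 ->
  quadpoly c a B v = mu + sigma *
    quadpoly (sigma^-1 * (c - mu)) (sigma^-1 *: a) (sigma^-1 *: B) v.
Proof.
move=> s0; rewrite /quadpoly !quadformE dotvZl -scalemxAl dotvZr; field; exact: s0.
Qed.

(** Reduces to mean 0 and variance 1: replacing Q by (Q - mu) / sigma divides
    the fourth-order quantities |B a|^2 and tr B^4 by sigma^4. *)
Lemma quadpoly_cvg_normal (disp : nat -> measure_display)
    (T : forall d, measurableType (disp d)) (P : forall d, probability (T d) R)
    (m : nat -> nat) (W : forall d, 'I_(m d) -> T d -> R)
    (c : nat -> R) (a : forall d, 'cV[R]_(m d)) (B : forall d, 'M[R]_(m d))
    (mu sigma : R) (h : R -> R) (K : R) :
  (forall d, gaussian_family (P d) (W d)) -> (forall d, (B d)^T = B d) ->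
  0 < sigma ->
  c d + \tr (B d) @[d --> \oo] --> mu ->
  dotv (a d) (a d) + 2 * \tr (B d *m B d) @[d --> \oo] --> sigma ^+ 2 ->
  dotv (B d *m a d) (B d *m a d) @[d --> \oo] --> (0 : R) ->
  \tr (B d *m B d *m (B d *m B d)) @[d --> \oo] --> (0 : R) ->
  continuous h -> (forall x, `|h x| <= K) ->
  \int[P d]_w h (quadpoly (c d) (a d) (B d) (vec (W d) w)) @[d --> \oo] -->
  \int[N]_u h (mu + sigma * u).
Proof.
move=> gW sB s0 Mc Sc Bac Bc ch hK; have s1 : sigma != 0 by rewrite gt_eqF.
apply: (@eq_cvgn _ (fun d => \int[P d]_w h (mu + sigma * quadpoly
    (sigma^-1 * (c d - mu)) (sigma^-1 *: a d) (sigma^-1 *: B d) (vec (W d) w)))).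
  by move=> d; apply: eq_Rintegral => w _; rewrite -quadpoly_affine.
apply: (@quadpoly_cvg_std_normal _ _ _ _ _
  (fun d => sigma^-1 * (c d - mu)) (fun d => sigma^-1 *: a d)
  (fun d => sigma^-1 *: B d) (fun u => h (mu + sigma * u)) K) => //.
- by move=> d; rewrite linearZ /= sB.
- apply: (@eq_cvgn _ (fun d => sigma^-1 * (c d + \tr (B d) - mu))).
    by move=> d; rewrite mxtraceZ; ring.
  rewrite -[X in _ --> X](_ : sigma^-1 * (mu - mu) = 0); last by rewrite subrr mulr0.
  by apply: cvgMr; apply: cvgB => //; exact: cvg_cst.
- apply: (@eq_cvgn _ (fun d => sigma ^- 2 * (dotv (a d) (a d) + 2 * \tr (B d *m B d)))).
    move=> d; rewrite dotvZl dotvZr -scalemxAl -scalemxAr !mxtraceZ.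
    by field; exact: s1.
  by rewrite -[X in _ --> X](mulVf (expf_neq0 2 s1)); exact: cvgMr.
- apply: (@eq_cvgn _ (fun d => sigma ^- 4 * dotv (B d *m a d) (B d *m a d))).
    move=> d; rewrite -scalemxAl -scalemxAr !dotvZl !dotvZr.
    by field; exact: s1.
  by rewrite -[X in _ --> X](mulr0 (sigma ^- 4)); exact: cvgMr.
- apply: (@eq_cvgn _ (fun d => sigma ^- 4 * \tr (B d *m B d *m (B d *m B d)))).
    move=> d.
    have e n (k l : R) (X Y : 'M[R]_n) : k *: X *m (l *: Y) = (k * l) *: (X *m Y).
      by rewrite -scalemxAl -scalemxAr scalerA.
    rewrite !e mxtraceZ.
    by field; exact: s1.
  by rewrite -[X in _ --> X](mulr0 (sigma ^- 4)); exact: cvgMr.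
- move=> x; apply: (@continuous_comp _ _ _ (fun u => mu + sigma * u) h); last exact: ch.
  by apply: cvgD; [exact: cvg_cst|apply: cvgMr; exact: cvg_id].
Qed.

End gaussian_limit.

(** * Normal distribution functions and convergence in distribution *)

Section normal_cdf.
Context {R : realType}.
Local Notation mu := (@lebesgue_measure R).
Local Notation N := (normal_prob (0 : R) 1).
Local Notation phi := (normal_pdf (0 : R) 1).

Lemma PhiE (t : R) : Phi t = \int[mu]_(x in `]-oo, t]) phi x.
Proof. by rewrite /Phi -set_itvNyc. Qed.

Lemma std_normal_prob_itvNyc (t : R) : N `]-oo, t] = (Phi t)%:E.
Proof.
by rewrite /Phi -set_itvNyc fineK//; exact: (@fin_num_measure _ _ _ N).
Qed.

Lemma Phi_continuous : continuous (Phi : R -> R).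
Proof.
have dPhi (x : R) : is_derive x 1 Phi (phi x).
  have -> : (Phi : R -> R) = fun t => \int[mu]_(x in `]-oo, t]) phi x.
    by apply/funext => t; exact: PhiE.
  have x1 : x < x + 1 by rewrite ltrDl.
  have cphi : {for x, continuous phi} by apply: continuous_normal_pdf; rewrite oner_eq0.
  have [] := continuous_FTC1 (a := -oo%O) x1 _ _ cphi.
  - exact: integrableS (integrable_normal_pdf 0 1).
  - by rewrite ltNyr.
  by move=> d1 <-; rewrite derive1E; exact: DeriveDef.
exact: is_derive_continuous dPhi.
Qed.

Lemma normal_pdf_standardize (m s x : R) : 0 < s ->
  normal_pdf m s (m + s * x) * s = phi x.
Proof.
move=> s0; have s1 : s != 0 by rewrite gt_eqF.
rewrite std_normal_pdfE normal_pdfE// mulrAC; congr (_ * _).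
  rewrite /normal_peak expr1n mul1r -mulrnAr sqrtrM ?sqr_ge0//.
  by rewrite sqrtr_sqr (gtr0_norm s0) invfM mulrAC mulVf ?mul1r.
rewrite /normal_fun; congr expR; field; exact: s1.
Qed.

Lemma normal_prob_itvNyc (m s t : R) : 0 < s ->
  normal_prob m s `]-oo, t] = (Phi ((t - m) / s))%:E.
Proof.
move=> s0; have s1 : s != 0 by rewrite gt_eqF.
rewrite -std_normal_prob_itvNyc /normal_prob.
set b := (t - m) / s; pose F x := m + s * x.
have Fb : t = F b by rewrite /F /b; field; exact: s1.
have dF (x : R) : is_derive x 1 F s.
  by apply: is_derive_eq; rewrite /GRing.scale /=; ring.
have F'E : F^`()%classic = cst s.
  by apply/funext => x; rewrite derive1E derive_val.
have cF := is_derive_continuous dF.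
rewrite Fb increasing_ge0_integration_by_substitutionNy.
- apply: eq_integral => x _; rewrite /= F'E /=.
  by congr EFin; exact: normal_pdf_standardize.
- by move=> x y _ _ xy; rewrite ltrD2l ltr_pM2l.
- by rewrite F'E => x _; exact: cvg_cst.
- by rewrite F'E; exact: is_cvg_cst.
- by rewrite F'E; exact: cvg_cst.
- split; first by move=> x _; have [] := dF x.
  by apply: cvg_at_left_filter; exact: cF.
- apply: (@cvg_trans _ (m + s * x @[x --> -oo])) => //.
  apply: cvg_comp (cvg_addrl_Ny m).
  by apply: gt0_cvgMrNy => //; exact: cvg_id.
- by apply: continuous_subspaceT; exact: continuous_normal_pdf.
- by move=> x _; exact: normal_pdf_ge0.
Qed.

Lemma std_normal_prob_itvoy (t : R) : N `]t, +oo[ = (Phi (- t))%:E.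
Proof.
rewrite -std_normal_prob_itvNyc -(@std_normal_probN R `]t, +oo[)//.
rewrite opp_preimage_itvbndy /normal_prob.
rewrite integral_itv_bndo_bndc//.
by apply/measurable_EFinP; apply: measurable_funTS; exact: measurable_normal_pdf.
Qed.

(** The exponential is below 1 for u <= - m / s, and there
    e^(m + s u) phi(u) = e^(m + s^2/2) phi(u - s). *)
Lemma std_normal_integral_min1_expR (m s : R) : 0 < s ->
  \int[N]_u Num.min 1 (expR (m + s * u)) =
  Phi (m / s) + expR (m + s ^+ 2 / 2) * Phi (- s - m / s).
Proof.
move=> s0; have s1 : s != 0 by rewrite gt_eqF.
pose g u := Num.min 1 (expR (m + s * u)).
have g01 u : `|g u| <= 1.
  by rewrite ger0_norm ?ge_min ?lexx// le_min ler01 expR_ge0.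
have cg : continuous g.
  move=> u; apply: (@continuous_min R R (fun=> 1) (fun u => expR (m + s * u)) u).
    exact: cvg_cst.
  apply: (@continuous_comp _ _ _ (fun u => m + s * u) expR); last exact: continuous_expR.
  by apply: cvgD; [exact: cvg_cst|apply: cvgMr; exact: cvg_id].
have mg := continuous_measurable_fun cg.
have iN : N.-integrable setT (EFin \o g).
  apply: (@le_integrable _ _ _ N _ measurableT _ (EFin \o cst 1)).
  - exact/measurable_EFinP.
  - by move=> x _; rewrite lee_fin; exact: le_trans (g01 x) (ler_norm _).
  - exact: finite_measure_integrable_cst.
have iL : mu.-integrable setT (EFin \o (fun u => g u * phi u)).
  exact/integrable_normal_prob.
pose u0 := - m / s.
have gE1 u : u <= u0 -> g u * phi u = expR (m + s ^+ 2 / 2) * normal_pdf s 1 u.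
  move=> uu0; have le0 : m + s * u <= 0.
    by move: uu0; rewrite /u0 ler_pdivlMr// mulrC => h; lra.
  rewrite /g min_r ?expR_le1//.
  rewrite std_normal_pdfE normal_pdfE ?oner_eq0// !(mulrCA _ (normal_peak 1)).
  congr (_ * _); rewrite /normal_fun -!expRD; congr expR.
  by rewrite expr1n; field.
have gE2 u : u0 < u -> g u * phi u = phi u.
  move=> uu0; have ge0 : 0 <= m + s * u.
    by move: uu0; rewrite /u0 ltr_pdivrMr// mulrC => h; lra.
  by rewrite /g min_l ?mul1r// -expR0 ler_expR.
rewrite Rintegral_normal_prob//.
have -> : \int[mu]_u (g u * phi u) =
    \int[mu]_(u in `]-oo, u0] `|` `]u0, +oo[) (g u * phi u) by rewrite itv_setU_setT.
rewrite Rintegral_setU//; first last.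
- apply/disj_setPS => y [] /=; rewrite !in_itv/= andbT => h1 h2.
  by have := lt_le_trans h2 h1; rewrite ltxx.
- by rewrite itv_setU_setT.
rewrite addrC; congr (_ + _).
  transitivity (\int[mu]_(u in `]u0, +oo[) phi u).
    by apply: eq_Rintegral => u; rewrite inE /= in_itv/= andbT => /gE2.
  transitivity (fine (N `]u0, +oo[)) => //.
  by rewrite std_normal_prob_itvoy /= /u0 mulNr opprK.
transitivity (\int[mu]_(u in `]-oo, u0]) (expR (m + s ^+ 2 / 2) * normal_pdf s 1 u)).
  by apply: eq_Rintegral => u; rewrite inE /= in_itv/= => /gE1.
have iP : mu.-integrable `]-oo, u0] (EFin \o normal_pdf s 1).
  exact: integrableS (integrable_normal_pdf s 1).
have nE : \int[mu]_(u in `]-oo, u0]) normal_pdf s 1 u = Phi (- s - m / s).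
  have := normal_prob_itvNyc s u0 (@ltr01 R); rewrite /normal_prob /Rintegral => ->.
  by rewrite divr1 /= /u0; congr Phi; rewrite addrC mulNr.
by rewrite -nE -RintegralZl.
Qed.

End normal_cdf.

Section convergence_in_distribution.
Context {R : realType}.
Local Notation N := (normal_prob (0 : R) 1).

(** Continuous, equal to 1 up to t and to 0 beyond t + delta. *)
Definition ramp (t delta x : R) : R := Num.min 1 (Num.max 0 (1 + (t - x) / delta)).

Lemma ramp_continuous (t delta : R) : continuous (ramp t delta).
Proof.
move=> x; apply: (@continuous_min R R (fun=> 1)
  (fun x => Num.max 0 (1 + (t - x) / delta)) x); first exact: cvg_cst.
apply: (@continuous_max R R (fun=> 0) (fun x => 1 + (t - x) / delta) x).
  exact: cvg_cst.
apply: cvgD; first exact: cvg_cst.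
by apply: cvgMl; apply: cvgB; [exact: cvg_cst|exact: cvg_id].
Qed.

Lemma ramp_ge0 (t delta x : R) : 0 <= ramp t delta x.
Proof. by rewrite le_min ler01 le_max lexx. Qed.

Lemma ramp_le1 (t delta x : R) : ramp t delta x <= 1.
Proof. by rewrite ge_min lexx. Qed.

Lemma ramp_bound (t delta x : R) : `|ramp t delta x| <= 1.
Proof. by rewrite ger0_norm ?ramp_ge0 ?ramp_le1. Qed.

Lemma ramp_ge_indic (t delta x : R) : 0 < delta ->
  \1_`]-oo, t] x <= ramp t delta x.
Proof.
move=> d0; rewrite indicE; have [xt|xt] := boolP (x \in _); last exact: ramp_ge0.
move: xt; rewrite inE /= in_itv /= => xt.
rewrite le_min lexx le_max; apply/orP; right.
by rewrite lerDl divr_ge0 ?subr_ge0// ltW.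
Qed.

Lemma ramp_le_indic (t delta x : R) : 0 < delta ->
  ramp t delta x <= \1_`]-oo, t + delta] x.
Proof.
move=> d0; rewrite indicE; have [xt|xt] := boolP (x \in _); first exact: ramp_le1.
move: xt; rewrite notin_setE /= in_itv /= => /negP; rewrite -ltNge => xt.
rewrite ge_min; apply/orP; right; rewrite ge_max lexx /=.
have : (t - x) / delta <= -1 by rewrite ler_pdivrMr// mulN1r; lra.
lra.
Qed.

Lemma measure_le_Rintegral (d : measure_display) (T : measurableType d)
    (P : probability T R) (F : T -> R) (h : R -> R) (t : R) :
  measurable_fun setT F -> continuous h -> (forall x, `|h x| <= 1) ->
  ((forall x, \1_`]-oo, t] x <= h x) ->
    fine (P (F @^-1` `]-oo, t])) <= \int[P]_w h (F w)) /\
  ((forall x, h x <= \1_`]-oo, t] x) ->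
    \int[P]_w h (F w) <= fine (P (F @^-1` `]-oo, t]))).
Proof.
move=> mF ch h1.
have mA : measurable (F @^-1` `]-oo, t]).
  by rewrite -[X in measurable X]setTI; exact: mF.
have E : fine (P (F @^-1` `]-oo, t])) = \int[P]_w \1_`]-oo, t] (F w).
  rewrite /Rintegral -(setIT (F @^-1` _)) -integral_indic//.
have iI : P.-integrable setT (EFin \o (fun w => \1_`]-oo, t] (F w) : R)).
  apply: (@le_integrable _ _ _ P _ measurableT _ (EFin \o cst 1)).
  - apply/measurable_EFinP; apply: (measurableT_comp _ mF).
    exact: measurable_indic.
  - by move=> w _; rewrite lee_fin normr1 indicE; case: (_ \in _); rewrite ?normr1 ?normr0.
  - exact: finite_measure_integrable_cst.
have ih : P.-integrable setT (EFin \o (fun w => h (F w))).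
  apply: (@le_integrable _ _ _ P _ measurableT _ (EFin \o cst 1)).
  - apply/measurable_EFinP; apply: (measurableT_comp _ mF).
    exact: continuous_measurable_fun.
  - by move=> w _; rewrite lee_fin normr1.
  - exact: finite_measure_integrable_cst.
by split => hI; rewrite E; apply: le_Rintegral.
Qed.

(** The limit l is e/2-close to both a and b, and p lies between v' and u'. *)
Lemma squeeze_dist (l a b u v u' v' p e : R) :
  `|l - a| < e / 2 -> `|l - b| < e / 2 -> u <= a -> b <= v ->
  `|u - u'| < e / 2 -> `|v - v'| < e / 2 -> p <= u' -> v' <= p -> `|l - p| < e.
Proof.
rewrite !ltr_norml => /andP[? ?] /andP[? ?] ? ? /andP[? ?] /andP[? ?] ? ?.
by apply/andP; split; lra.
Qed.

(** Ramps ending at t + dl and at t bound the indicator of ]-oo, t] from above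
    and below. Their normal integrals lie within the values of the limiting
    distribution function at t + dl and t - dl, and that function is continuous. *)
Lemma cvg_in_distribution_normal (disp : nat -> measure_display)
    (T : forall d, measurableType (disp d)) (P : forall d, probability (T d) R)
    (F : forall d, T d -> R) (m s : R) :
  0 < s -> (forall d, measurable_fun setT (F d)) ->
  (forall (h : R -> R), continuous h -> (forall x, `|h x| <= 1) ->
    \int[P d]_w h (F d w) @[d --> \oo] --> \int[N]_u h (m + s * u)) ->
  cvg_in_distribution P F (normal_prob m s).
Proof.
move=> s0 mF hF; split=> // t _.
pose p d := fine (P d (F d @^-1` `]-oo, t])).
pose L x := Phi ((x - m) / s).
have pE d : P d [set w | F d w <= t] = (p d)%:E.
  rewrite /p fineK//.
  apply: (@fin_num_measure _ _ _ (P d)); rewrite -[X in measurable X]setTI.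
  exact: mF.
rewrite -set_itvNyc normal_prob_itvNyc//.
under eq_fun do rewrite pE.
apply: cvg_EFin; first by apply: nearW.
rewrite -/(L t).
have mlin : measurable_fun setT (fun u : R => m + s * u).
  apply: continuous_measurable_fun => u.
  by apply: cvgD; [exact: cvg_cst|apply: cvgMr; exact: cvg_id].
have Lpre x : fine (N ((fun u => m + s * u) @^-1` `]-oo, x])) = L x.
  rewrite (_ : _ @^-1` _ = `]-oo, (x - m) / s]%classic) ?std_normal_prob_itvNyc//.
  apply/seteqP; split => u /=; rewrite !in_itv/= ler_pdivlMr//; lra.
have cL : continuous L.
  move=> x; apply: (@continuous_comp _ _ _ (fun x => (x - m) / s) Phi); last exact: Phi_continuous.
  by apply: cvgMl; apply: cvgB; [exact: cvg_id|exact: cvg_cst].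
apply/cvgrPdist_lt => e e0.
have e2 : 0 < e / 2 by rewrite divr_gt0.
have [dl dl0 Ldl] : exists2 dl : R, 0 < dl & `|L t - L (t + dl)| < e / 2 /\ `|L t - L (t - dl)| < e / 2.
  have /cvgrPdist_lt /(_ _ e2) /nbhs_ballP[r /= r0 Hr] := cL t.
  exists (r / 2); first by rewrite divr_gt0.
  have rr : r / 2 < r by rewrite ltr_pdivrMr// ltr_pMr// ltr1n.
  split; apply: Hr; rewrite /ball /=.
    by rewrite opprD addrA subrr sub0r normrN gtr0_norm ?divr_gt0.
  by rewrite opprB addrC subrK gtr0_norm ?divr_gt0.
have U := hF _ (@ramp_continuous t dl) (ramp_bound t dl).
have D := hF _ (@ramp_continuous (t - dl) dl) (ramp_bound (t - dl) dl).
have Ulim : \int[N]_u ramp t dl (m + s * u) <= L (t + dl).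
  rewrite -Lpre.
  have [_] := @measure_le_Rintegral _ _ N _ _ (t + dl) mlin (@ramp_continuous t dl) (ramp_bound t dl).
  by apply=> x; exact: ramp_le_indic.
have Dlim : L (t - dl) <= \int[N]_u ramp (t - dl) dl (m + s * u).
  rewrite -Lpre.
  have [+ _] := @measure_le_Rintegral _ _ N _ _ (t - dl) mlin (@ramp_continuous (t - dl) dl) (ramp_bound (t - dl) dl).
  by apply=> x; exact: ramp_ge_indic.
move/cvgrPdist_lt : U => /(_ _ e2) U; move/cvgrPdist_lt : D => /(_ _ e2) D.
near=> d.
have Ud : p d <= \int[P d]_w ramp t dl (F d w).
  have [+ _] := measure_le_Rintegral (P d) t (mF d) (@ramp_continuous t dl) (ramp_bound t dl).
  by apply=> x; exact: ramp_ge_indic.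
have Dd : \int[P d]_w ramp (t - dl) dl (F d w) <= p d.
  have [_] := measure_le_Rintegral (P d) t (mF d) (@ramp_continuous (t - dl) dl) (ramp_bound (t - dl) dl).
  by apply=> x; have := @ramp_le_indic (t - dl) dl x dl0; rewrite subrK.
have U' : `|\int[N]_u ramp t dl (m + s * u) - \int[P d]_w ramp t dl (F d w)| < e / 2.
  by near: d.
have D' : `|\int[N]_u ramp (t - dl) dl (m + s * u) -
    \int[P d]_w ramp (t - dl) dl (F d w)| < e / 2.
  by near: d.
exact: squeeze_dist Ldl.1 Ldl.2 Ulim Dlim U' D' Ud Dd.
Unshelve. all: by end_near. Qed.

End convergence_in_distribution.

(** * Functions of a symmetric matrix and its square root *)

Section eigenbasis.
Context {R : realType} {n : nat}.
Implicit Types (f g : 'I_n -> R) (v : 'cV[R]_n).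

(** The matrix with orthonormal eigenvectors the columns of Q and eigenvalues f. *)
Definition eigmx (Q : 'M[R]_n) f : 'M[R]_n := Q *m diag_mx (\row_i f i) *m Q^T.

Variable Q : 'M[R]_n.
Hypothesis QQT : Q *m Q^T = 1%:M.

Let QTQ : Q^T *m Q = 1%:M. Proof. exact: mulmx1C. Qed.

Lemma eigmxM f g : eigmx Q f *m eigmx Q g = eigmx Q (fun i => f i * g i).
Proof.
rewrite /eigmx -!mulmxA; congr (_ *m _); rewrite !mulmxA; congr (_ *m _).
rewrite -[_ *m Q^T *m Q]mulmxA QTQ mulmx1 mulmx_diag; congr diag_mx.
by apply/rowP => i; rewrite !mxE.
Qed.

Lemma eigmxD f g : eigmx Q f + eigmx Q g = eigmx Q (fun i => f i + g i).
Proof.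
rewrite /eigmx -mulmxDl -mulmxDr; congr (_ *m _ *m _); rewrite -raddfD.
by congr diag_mx; apply/rowP => i; rewrite !mxE.
Qed.

Lemma eigmxN f : - eigmx Q f = eigmx Q (fun i => - f i).
Proof.
rewrite /eigmx -mulNmx -mulmxN; congr (_ *m _ *m _); rewrite -raddfN.
by congr diag_mx; apply/rowP => i; rewrite !mxE.
Qed.

Lemma eigmx1 : eigmx Q (fun=> 1) = 1%:M.
Proof.
rewrite /eigmx (_ : \row_i 1 = const_mx 1); last by apply/rowP => i; rewrite !mxE.
by rewrite diag_const_mx mulmx1.
Qed.

Lemma eigmx_tr f : (eigmx Q f)^T = eigmx Q f.
Proof. by rewrite /eigmx !trmx_mul trmxK tr_diag_mx mulmxA. Qed.

Lemma eq_eigmx f g : f =1 g -> eigmx Q f = eigmx Q g.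
Proof.
by move=> fg; rewrite /eigmx; congr (_ *m diag_mx _ *m _); apply/rowP => i; rewrite !mxE.
Qed.

Lemma invmx_eigmx f : (forall i, f i != 0) ->
  invmx (eigmx Q f) = eigmx Q (fun i => (f i)^-1).
Proof.
move=> f0; have H : eigmx Q f *m eigmx Q (fun i => (f i)^-1) = 1%:M.
  by rewrite eigmxM -eigmx1; apply: eq_eigmx => i; rewrite divff.
have [u _] := mulmx1_unit H.
by rewrite -[LHS]mulmx1 -H mulmxA mulVmx// mul1mx.
Qed.

Lemma det_eigmx f : \det (eigmx Q f) = \prod_i f i.
Proof.
rewrite /eigmx !det_mulmx det_diag mulrAC -det_mulmx QQT det1 mul1r.
by apply: eq_bigr => i _; rewrite mxE.
Qed.

Lemma eigmx_coord f v i : (Q^T *m (eigmx Q f *m v)) i ord0 = f i * (Q^T *m v) i ord0.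
Proof.
rewrite /eigmx !mulmxA QTQ mul1mx -mulmxA mul_diag_mx.
by rewrite mxE mxE.
Qed.

Lemma coord_inj v1 v2 : Q^T *m v1 = Q^T *m v2 -> v1 = v2.
Proof. by move=> /(congr1 (mulmx Q)); rewrite !mulmxA QQT !mul1mx. Qed.

Lemma coord_basis i j : (Q^T *m col i Q) j ord0 = (j == i)%:R.
Proof.
have := congr1 (fun X : 'M[R]_n => X j i) QTQ; rewrite !mxE => <-.
by apply: eq_bigr => k _; rewrite !mxE.
Qed.

Lemma eigmx_eigenvalue f (c : R) i : eigmx Q f *m col i Q = c *: col i Q -> f i = c.
Proof.
move=> /(congr1 (fun v => (Q^T *m v) i ord0)).
by rewrite eigmx_coord -scalemxAr [X in _ = X -> _]mxE !coord_basis eqxx !mulr1.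
Qed.

Lemma quadform_eigmx f v :
  quadform (eigmx Q f) v = \sum_i f i * (Q^T *m v) i ord0 ^+ 2.
Proof.
rewrite quadformE /eigmx /dotv -!mulmxA (mulmxA v^T) -[v^T *m Q]trmxK trmx_mul trmxK.
rewrite mxE; apply: eq_bigr => i _.
by rewrite mul_diag_mx !mxE; ring.
Qed.

Lemma quadform_ge0_diag (B : 'M[R]_n) : (forall v, 0 <= quadform B v) ->
  \tr B = 0 -> forall i, B i i = 0.
Proof.
move=> B0 trB i.
have Bi j : 0 <= B j j.
  by have := B0 (delta_mx j ord0); rewrite quadformE dotvC dotv_delta mulmx_delta.
by apply/eqP; move: trB => /eqP; rewrite /mxtrace psumr_eq0// => /allP /(_ i (mem_index_enum i)).
Qed.

(** Put X = S - D and Z = S + D. Equality of the squares means XZ + ZX = 0,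
    whence tr (XZX) = 0. As XZX is positive semidefinite its diagonal vanishes,
    and Z being positive definite, every column of X is 0. *)
Lemma psd_sqrtmx_unique (S D : 'M[R]_n) : S^T = S -> D^T = D ->
  (forall v, 0 <= quadform S v) -> (forall v, v != 0 -> 0 < quadform D v) ->
  S *m S = D *m D -> S = D.
Proof.
move=> sS sD S0 D0 SD; pose X := S - D; pose Z := S + D.
have sX : X^T = X by rewrite /X linearB /= sS sD.
have XZ : X *m Z + Z *m X = 0.
  rewrite /X /Z !mulmxDl !mulmxDr !mulNmx !mulmxN SD.
  apply/matrixP => i j; rewrite !mxE; ring.
have trXZX : \tr (X *m Z *m X) = 0.
  have : \tr (X *m (X *m Z + Z *m X)) = 0 by rewrite XZ mulmx0 mxtrace0.
  rewrite mulmxDr mxtraceD -mulmxA mxtrace_mulC mulmxA => h.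
  by move: h; set t := \tr _; lra.
have Z0 v : v != 0 -> 0 < quadform Z v.
  move=> v0; rewrite quadformE /Z mulmxDl dotvDr -!quadformE.
  by rewrite ltr_wpDl ?S0 ?D0.
have Z00 v : 0 <= quadform Z v.
  have [->|/Z0/ltW//] := eqVneq v 0.
  by rewrite quadformE mulmx0 /dotv mulmx0 mxE.
have XZX0 v : 0 <= quadform (X *m Z *m X) v.
  suff -> : quadform (X *m Z *m X) v = quadform Z (X *m v) by [].
  by rewrite /quadform trmx_mul sX !mulmxA.
suff X0 : X = 0 by apply/eqP; rewrite -subr_eq0 -/X X0.
apply/matrixP => i j; rewrite [RHS]mxE.
have := quadform_ge0_diag XZX0 trXZX j.
have -> : (X *m Z *m X) j j = quadform Z (X *m delta_mx j ord0).
  rewrite /quadform trmx_mul sX !mulmxA.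
  by rewrite -!mulmxA -/(dotv _ _) dotvC dotv_delta !mulmxA mulmx_delta.
have [Xj0 _|Xj0] := eqVneq (X *m delta_mx j ord0 : 'cV[R]_n) 0.
  by rewrite -mulmx_delta Xj0 mxE.
by move=> h; have := Z0 _ Xj0; rewrite h ltxx.
Qed.

(** The chosen square root is the one with the positive square roots of the
    eigenvalues, by uniqueness. *)
Lemma sqrtmx_eigmx f : (forall i, 0 < f i) ->
  sqrtmx (eigmx Q (fun i => f i ^+ 2)) = eigmx Q f.
Proof.
move=> f0.
have pos v : v != 0 -> 0 < quadform (eigmx Q f) v.
  move=> v0; rewrite quadform_eigmx lt_neqAle; apply/andP; split; last first.
    by apply: sumr_ge0 => i _; rewrite mulr_ge0 ?sqr_ge0// ltW.
  apply: contra v0; rewrite eq_sym psumr_eq0; last first.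
    by move=> i _; rewrite mulr_ge0 ?sqr_ge0// ltW.
  move=> /allP h; apply/eqP/coord_inj/matrixP => i j; rewrite (ord1 j) mulmx0 [RHS]mxE.
  have := h i (mem_index_enum i); rewrite /= mulf_eq0 (gt_eqF (f0 i)) /= sqrf_eq0.
  by move/eqP.
have rt : is_sqrtmx (eigmx Q (fun i => f i ^+ 2)) (eigmx Q f).
  split; [exact: eigmx_tr| |by rewrite eigmxM].
  move=> v; have [->|/pos/ltW//] := eqVneq v 0.
  by rewrite quadformE mulmx0 /dotv mulmx0 mxE.
rewrite /sqrtmx; have := @xgetPex _ 0 [set S | is_sqrtmx (eigmx Q (fun i => f i ^+ 2)) S].
move=> /(_ (ex_intro _ _ rt)) [s1 s2 s3].
apply: psd_sqrtmx_unique => //; first exact: eigmx_tr.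
by rewrite s3; case: rt.
Qed.

End eigenbasis.

(** * The Metropolis-Hastings ratio in the eigenbasis *)

Section mh_log_ratio.
Context {R : realType}.

(** The normalising constants cancel, as both densities of each quotient have
    the same covariance. *)
Lemma mh_ratio_mvn n (m0 : 'cV[R]_n) (C0 C1 : 'M[R]_n)
    (mean : 'cV[R]_n -> 'cV[R]_n) (x y : 'cV[R]_n) :
  0 < \det C0 -> 0 < \det C1 ->
  mh_ratio (mvn_pdf m0 C0) (fun z => mvn_pdf (mean z) C1) x y =
  expR (- ((quadform (invmx C0) (y - m0) - quadform (invmx C0) (x - m0)) / 2
         + (quadform (invmx C1) (x - mean y) - quadform (invmx C1) (y - mean x)) / 2)).
Proof.
move=> d0 d1; rewrite /mh_ratio /mvn_pdf.
have K (C : 'M[R]_n) : 0 < \det C -> Num.sqrt ((2 * pi) ^+ n * \det C) != 0.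
  by move=> dC; rewrite gt_eqF// sqrtr_gt0 mulr_gt0// exprn_gt0// mulr_gt0 ?pi_gt0.
have K0 := K _ d0; have K1 := K _ d1.
set a := quadform (invmx C0) (y - m0); set b := quadform (invmx C0) (x - m0).
set c := quadform (invmx C1) (x - mean y); set e := quadform (invmx C1) (y - mean x).
rewrite (_ : - ((a - b) / 2 + (c - e) / 2) = - (a / 2) - (c / 2) - (- (b / 2)) - (- (e / 2))); last by ring.
rewrite !(expRD (_ - _)) (expRD (- (a / 2))) !expRN.
have ne0 (u : R) : expR u != 0 by rewrite gt_eqF ?expR_gt0.
have ea := ne0 (a / 2); have eb := ne0 (b / 2).
have ec := ne0 (c / 2); have ee := ne0 (e / 2).
by field; rewrite ea eb ec ee K0 K1.
Qed.

(** In one eigendirection, l (x - m) = nu and s^2 = 1 - G^2. With p = x - tm and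
    q = y - tm, the identity (p - G q)^2 - (q - G p)^2 = (1 - G^2) (p^2 - q^2) is
    detailed balance of the proposal with respect to the normal law of mean tm
    and precision tl^2; it removes the denominator 1 - G^2. *)
Lemma mh_exponent_coord (l tl G m tm nu ze s : R) :
  l != 0 -> tl != 0 -> s != 0 -> s ^+ 2 = 1 - G ^+ 2 ->
  let x := m + nu / l in
  let y := G * x + (1 - G) * tm + s / tl * ze in
  let r := (l ^+ 2 - tl ^+ 2) / l ^+ 2 in
  let rh := m - tm in
  - ((l ^+ 2 * (y - m) ^+ 2 - l ^+ 2 * (x - m) ^+ 2) / 2
   + (tl ^+ 2 / (1 - G ^+ 2) * (x - (G * y + (1 - G) * tm)) ^+ 2
      - tl ^+ 2 / (1 - G ^+ 2) * (y - (G * x + (1 - G) * tm)) ^+ 2) / 2) =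
  rh ^+ 2 * l ^+ 2 * (2^-1 * r * (1 - G ^+ 2) - (1 - G))
  + rh * l * (r * (1 - G ^+ 2) - (1 - G)) * nu
  + rh * l * s * (l / tl) * (1 - r * G) * ze
  + 2^-1 * r * (1 - G ^+ 2) * nu ^+ 2
  + (- (2^-1 * r * (1 - G ^+ 2) * (l / tl) ^+ 2)) * ze ^+ 2
  + (- (r * G * s * (l / tl))) * (nu * ze).
Proof.
move=> l0 tl0 s0 s2 x y r rh.
have g0 : 1 - G ^+ 2 != 0 by rewrite -s2 expf_neq0.
have -> : - ((l ^+ 2 * (y - m) ^+ 2 - l ^+ 2 * (x - m) ^+ 2) / 2
   + (tl ^+ 2 / (1 - G ^+ 2) * (x - (G * y + (1 - G) * tm)) ^+ 2
      - tl ^+ 2 / (1 - G ^+ 2) * (y - (G * x + (1 - G) * tm)) ^+ 2) / 2) =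
   - ((l ^+ 2 * (y - m) ^+ 2 - l ^+ 2 * (x - m) ^+ 2) / 2
   + tl ^+ 2 * ((x - tm) ^+ 2 - (y - tm) ^+ 2) / 2).
  by field.
rewrite /r /rh /y /x.
apply/eqP; rewrite -subr_eq0; apply/eqP.
(* The two sides agree modulo s^2 = 1 - G^2, which only the term in ze^2
   needs. *)
transitivity (- (l ^+ 2 - tl ^+ 2) / 2 * (ze / tl) ^+ 2 * (s ^+ 2 - (1 - G ^+ 2))).
  by field; rewrite l0 tl0.
by rewrite s2 subrr mulr0.
Qed.

End mh_log_ratio.

Section splitting.
Context {R : realType} {n : nat}.
Variables (A M N Q : 'M[R]_n) (b beta : 'cV[R]_n) (lam tlam G : 'I_n -> R).
Hypotheses (MTDN_posdef : posdefmx (M^T + N))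
  (M_unit : M \in unitmx)
  (lam_gt0 : forall i, 0 < lam i) (tlam_gt0 : forall i, 0 < tlam i)
  (A_spectral : spectral_decomposition A Q (\row_i lam i ^+ 2))
  (M_fun : is_function_of Q (\row_i lam i ^+ 2) M)
  (N_fun : is_function_of Q (\row_i lam i ^+ 2) N)
  (MBN_eigen : forall i, (M - N) *m col i Q = tlam i ^+ 2 *: col i Q)
  (G_eigen : forall i, itermx M N *m col i Q = G i *: col i Q).

Let QQT : Q *m Q^T = 1%:M. Proof. by case: A_spectral. Qed.

Lemma col_coord (v : 'cV[R]_n) i : ((col i Q)^T *m v) ord0 ord0 = (Q^T *m v) i ord0.
Proof. by rewrite !mxE; apply: eq_bigr => j _; rewrite !mxE. Qed.

Lemma function_of_eigmx (F : 'M[R]_n) :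
  is_function_of Q (\row_i lam i ^+ 2) F -> exists f, F = eigmx Q f.
Proof.
move=> [f ->]; exists (fun i => f (lam i ^+ 2)); rewrite /eigmx.
by congr (_ *m diag_mx _ *m _); apply/rowP => i; rewrite !mxE.
Qed.

(** If M and N have eigenvalues m and n, then m - n = tlam^2 > 0, and m + n > 0
    because M^T + N is positive definite; since G = n / m,
    1 - G^2 = (m - n) (m + n) / m^2 > 0. *)
Lemma splitting_eigenvalues : exists fm fn : 'I_n -> R,
  [/\ M = eigmx Q fm, N = eigmx Q fn, forall i, fm i != 0,
      forall i, tlam i ^+ 2 = fm i - fn i &
      forall i, G i = fn i / fm i /\ 0 < 1 - G i ^+ 2].
Proof.
have [fm Mfm] := function_of_eigmx M_fun; have [fn Nfn] := function_of_eigmx N_fun.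
have fm0 i : fm i != 0.
  have : \det M != 0 by rewrite -unitfE -unitmxE.
  by rewrite Mfm det_eigmx// => /prodf_neq0; exact.
have tl i : tlam i ^+ 2 = fm i - fn i.
  apply/esym/(eigmx_eigenvalue QQT (f := fun i => fm i - fn i)).
  by rewrite -MBN_eigen Mfm Nfn eigmxN eigmxD.
have Gi i : G i = fn i / fm i.
  rewrite mulrC; apply/esym/(eigmx_eigenvalue QQT (f := fun i => (fm i)^-1 * fn i)).
  by rewrite -G_eigen /itermx Mfm Nfn (invmx_eigmx QQT)// eigmxM.
have sum0 i : 0 < fm i + fn i.
  have q0 : col i Q != 0.
    apply/eqP => q0; have := coord_basis QQT i i.
    by rewrite q0 mulmx0 mxE eqxx => /eqP; rewrite eq_sym oner_eq0.
  have := MTDN_posdef.2 _ q0.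
  rewrite Mfm Nfn eigmx_tr eigmxD quadform_eigmx (bigD1 i)//= big1.
    by rewrite addr0 coord_basis// eqxx expr1n mulr1.
  by move=> j /negbTE ji; rewrite coord_basis// ji expr0n mulr0.
exists fm, fn; split=> // i; split=> //.
have d0 : 0 < fm i - fn i by rewrite -tl exprn_gt0.
rewrite Gi (_ : 1 - _ = (fm i - fn i) * (fm i + fn i) / fm i ^+ 2); last first.
  by field; exact: fm0.
apply: divr_gt0; first exact: mulr_gt0.
by rewrite exprn_even_gt0/=.
Qed.

(** The covariance (1 - G^2) / tlam^2, written as a square for the sake of its
    square root. *)
Lemma noise_cov_eigen :
  noise_cov M N = eigmx Q (fun i => (Num.sqrt (1 - G i ^+ 2) / tlam i) ^+ 2).
Proof.
have [fm [fn [Mfm Nfn fm0 tl GE]]] := splitting_eigenvalues.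
have tl0 i : tlam i != 0 by rewrite gt_eqF.
have iter : itermx M N = eigmx Q G.
  rewrite /itermx Mfm Nfn (invmx_eigmx QQT)// eigmxM//.
  by apply: eq_eigmx => i; rewrite (GE i).1 mulrC.
have MN : M - N = eigmx Q (fun i => tlam i ^+ 2).
  by rewrite Mfm Nfn eigmxN eigmxD; apply: eq_eigmx => i; rewrite tl.
rewrite /noise_cov iter MN (invmx_eigmx QQT); last by move=> i; rewrite expf_neq0.
rewrite eigmx_tr !eigmxM// eigmxN eigmxD; apply: eq_eigmx => i.
rewrite expr_div_n sqr_sqrtr; last by rewrite ltW// (GE i).2.
by field; exact: tl0.
Qed.

(** The fixed point of x |-> G x + M^-1 beta is (M - N)^-1 beta, so each
    coordinate is an affine combination of x and this fixed point with weights G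
    and 1 - G. *)
Lemma proposal_mean_coord x i :
  (Q^T *m proposal_mean M N beta x) i ord0 =
  G i * (Q^T *m x) i ord0 +
  (1 - G i) * ((col i Q)^T *m invmx (M - N) *m beta) ord0 ord0.
Proof.
have [fm [fn [Mfm Nfn fm0 tl GE]]] := splitting_eigenvalues.
have MN : M - N = eigmx Q (fun i => tlam i ^+ 2).
  by rewrite Mfm Nfn eigmxN eigmxD; apply: eq_eigmx => j; rewrite tl.
rewrite -mulmxA col_coord MN (invmx_eigmx QQT); last first.
  by move=> j; rewrite expf_neq0// gt_eqF.
rewrite /proposal_mean /itermx Mfm Nfn (invmx_eigmx QQT)// eigmxM//.
rewrite mulmxDr mxE !eigmx_coord// (GE i).1 tl.
have d0 : fm i - fn i != 0 by rewrite -tl expf_neq0// gt_eqF.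
by field; rewrite fm0 d0.
Qed.

Lemma A_eigen : A = eigmx Q (fun i => lam i ^+ 2).
Proof. by case: A_spectral. Qed.

(** All quadratic forms in the exponent are diagonal in the basis of the q_i,
    and each direction contributes one instance of [mh_exponent_coord]. In
    equilibrium the nu_i and ze_i are standard normal. *)
Lemma mh_ratio_eigen (x xi : 'cV[R]_n) :
  let T i := T_coef (lam i) (tlam i) (G i)
    (((col i Q)^T *m invmx A *m b) ord0 ord0
     - ((col i Q)^T *m invmx (M - N) *m beta) ord0 ord0) in
  let nu i := lam i * (Q^T *m (x - invmx A *m b)) i ord0 in
  let ze i := (Q^T *m xi) i ord0 in
  mh_ratio (target_pdf A b) (proposal_pdf M N beta) x (proposal M N beta x xi) =
  expR (\sum_i (T i 0%N + T i 1%N * nu i + T i 2%N * ze i + T i 3%N * nu i ^+ 2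
    + T i 4%N * ze i ^+ 2 + T i 5%N * (nu i * ze i))).
Proof.
move=> T nu ze.
have [fm [fn [Mfm Nfn fm0 tl GE]]] := splitting_eigenvalues.
have tl0 i : tlam i != 0 by rewrite gt_eqF.
have l0 i : lam i != 0 by rewrite gt_eqF.
have s0 i : 0 < Num.sqrt (1 - G i ^+ 2) by rewrite sqrtr_gt0 (GE i).2.
have s2 i : Num.sqrt (1 - G i ^+ 2) ^+ 2 = 1 - G i ^+ 2.
  by rewrite sqr_sqrtr// ltW// (GE i).2.
have l20 i : lam i ^+ 2 != 0 by rewrite expf_neq0.
have c0 i : (Num.sqrt (1 - G i ^+ 2) / tlam i) ^+ 2 != 0.
  by rewrite expf_neq0// mulf_neq0 ?invr_neq0// gt_eqF.
have iA : invmx A = eigmx Q (fun i => (lam i ^+ 2)^-1).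
  by rewrite A_eigen (invmx_eigmx QQT).
rewrite /target_pdf (mh_ratio_mvn _ (proposal_mean M N beta)); last 2 first.
- by rewrite iA det_eigmx// prodr_gt0// => i _; rewrite invr_gt0 exprn_gt0.
- rewrite noise_cov_eigen det_eigmx// prodr_gt0// => i _.
  by rewrite exprn_even_gt0/= ?mulf_neq0 ?invr_neq0// gt_eqF.
congr expR.
have iiA : invmx (invmx A) = eigmx Q (fun i => lam i ^+ 2).
  by rewrite invmxK A_eigen.
rewrite iiA noise_cov_eigen (invmx_eigmx QQT)// !quadform_eigmx.
rewrite -!sumrB !mulr_suml -big_split -sumrN /=; apply: eq_bigr => i _.
set m := ((col i Q)^T *m invmx A *m b) ord0 ord0 in T *.
set tm := ((col i Q)^T *m invmx (M - N) *m beta) ord0 ord0 in T *.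
have mE : (Q^T *m (invmx A *m b)) i ord0 = m by rewrite /m -mulmxA col_coord.
have subE (v1 v2 : 'cV[R]_n) : (Q^T *m (v1 - v2)) i ord0 =
    (Q^T *m v1) i ord0 - (Q^T *m v2) i ord0 by rewrite mulmxBr mxE [in X in _ + X]mxE.
have xE : (Q^T *m x) i ord0 = m + nu i / lam i.
  by rewrite /nu subE mE; field; exact: l0.
have yE : (Q^T *m proposal M N beta x xi) i ord0 =
    G i * (m + nu i / lam i) + (1 - G i) * tm + Num.sqrt (1 - G i ^+ 2) / tlam i * ze i.
  rewrite /proposal mulmxDr mxE proposal_mean_coord xE; congr (_ + _).
  rewrite noise_cov_eigen sqrtmx_eigmx// ?eigmx_coord// => j.
  by rewrite divr_gt0.
rewrite !subE !proposal_mean_coord -/tm mE yE xE.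
have e : ((Num.sqrt (1 - G i ^+ 2) / tlam i) ^+ 2)^-1 = tlam i ^+ 2 / (1 - G i ^+ 2).
  by rewrite expr_div_n s2 invf_div.
rewrite e.
have := mh_exponent_coord m tm (nu i) (ze i) (l0 i) (tl0 i) (lt0r_neq0 (s0 i)) (s2 i).
move=> /= ->.
have sq : Num.sqrt (1 + (lam i ^+ 2 - tlam i ^+ 2) / tlam i ^+ 2) = lam i / tlam i.
  rewrite (_ : 1 + _ = (lam i / tlam i) ^+ 2); last by field; exact: tl0.
  by rewrite sqrtr_sqr gtr0_norm// divr_gt0.
have tr : 1 + (lam i ^+ 2 - tlam i ^+ 2) / tlam i ^+ 2 = (lam i / tlam i) ^+ 2.
  by field; exact: tl0.
by rewrite /T /T_coef sq tr.
Qed.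

End splitting.

(** * The log-ratio as a quadratic polynomial of a normal vector *)

Section joint_gaussian.
Context {R : realType} {d : measure_display} {T : measurableType d}
  (P : probability T R) {n : nat}.
Local Notation N := (normal_prob (0 : R) 1).

Definition joint_family (z xi : T -> n.-tuple R) (k : 'I_(n + n)) (w : T) : R :=
  match fintype.split k with inl i => tnth (z w) i | inr j => tnth (xi w) j end.

Lemma vec_joint_family (z xi : T -> n.-tuple R) w :
  vec (joint_family z xi) w = col_mx (cvec (z w)) (cvec (xi w)).
Proof.
apply/matrixP => k j; rewrite (ord1 j) /vec mxE /joint_family.
by case: fintype.splitP => i ki; [rewrite (_ : k = lshift n i)|rewrite (_ : k = rshift n i)];
  rewrite ?col_mxEu ?col_mxEd ?mxE//; exact: val_inj.
Qed.

Lemma measurable_affine_box (L : 'M[R]_n) (m0 : 'cV[R]_n) (B : 'I_n -> set R) :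
  (forall i, measurable (B i)) ->
  measurable [set t : n.-tuple R | forall i, B i ((L *m (cvec t - m0)) i ord0)].
Proof.
move=> mB.
rewrite (_ : [set t | _] = \bigcap_(i in [set: 'I_n])
    ((fun t : n.-tuple R => (L *m (cvec t - m0)) i ord0) @^-1` B i)); last first.
  by apply/seteqP; split => t /= h i; [move=> _; exact: h|exact: (h i)].
apply: fin_bigcap_measurable => // i _; rewrite -[X in measurable X]setTI.
suff mf : measurable_fun setT (fun t : n.-tuple R => (L *m (cvec t - m0)) i ord0).
  exact: mf.
under eq_fun do rewrite mxE.
apply: measurable_sum => j; apply: measurable_funM => //.
under eq_fun do rewrite !mxE.
by apply: measurable_funB => //; exact: measurable_tnth.
Qed.

Lemma standard_normal_box (z : {RV P >-> n.-tuple R}) (B : 'I_n -> set R) :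
  standard_normal z -> (forall i, measurable (B i)) ->
  P [set w | forall i, B i (tnth (z w) i)] = (\prod_i fine (N (B i)))%:E.
Proof.
move=> [ind nz] mB; rewrite (ind B mB); congr EFin; apply: eq_bigr => i _.
by congr fine; exact: nz.
Qed.

(** Independence is known between x and xi; it passes to z because
    z = L^-1 (x - m0) is a function of x. *)
Lemma gaussian_joint_family (x z xi : {RV P >-> n.-tuple R}) (m0 : 'cV[R]_n) (L : 'M[R]_n) :
  standard_normal z -> standard_normal xi -> independent P x xi ->
  L \in unitmx -> (forall w, cvec (x w) = m0 + L *m cvec (z w)) ->
  gaussian_family P (joint_family z xi).
Proof.
move=> nz nxi ind uL xE; split.
  move=> k; rewrite /joint_family; case: (fintype.split k) => i.
    by apply: (measurableT_comp (measurable_tnth i)).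
  by apply: (measurableT_comp (measurable_tnth i)).
move=> B mB.
pose Dz := [set t : n.-tuple R | forall i, B (lshift n i) ((invmx L *m (cvec t - m0)) i ord0)].
(* the identity matrix and the shift by 0 give Dx the form of Dz *)
pose Dx := [set t : n.-tuple R | forall i, B (rshift n i) ((1%:M *m (cvec t - 0)) i ord0)].
have mDz : measurable Dz.
  by apply: (@measurable_affine_box _ _ (fun i => B (lshift n i))) => i; exact: mB.
have mDx : measurable Dx.
  by apply: (@measurable_affine_box _ _ (fun i => B (rshift n i))) => i; exact: mB.
have zE : x @^-1` Dz = [set w | forall i, B (lshift n i) (tnth (z w) i)].
  have e w i : (invmx L *m (cvec (x w) - m0)) i ord0 = tnth (z w) i.
    by rewrite xE addrAC subrr add0r mulmxA mulVmx// mul1mx mxE.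
  by apply/seteqP; split => w /= h i; have := h i; rewrite e.
have xiE : xi @^-1` Dx = [set w | forall i, B (rshift n i) (tnth (xi w) i)].
  have e w i : (1%:M *m (cvec (xi w) - 0)) i ord0 = tnth (xi w) i.
    by rewrite subr0 mul1mx mxE.
  by apply/seteqP; split => w /= h i; have := h i; rewrite e.
have -> : [set w | forall k, B k (joint_family z xi k w)] = x @^-1` Dz `&` xi @^-1` Dx.
  rewrite zE xiE; apply/seteqP; split => w /=.
    move=> h; split => i; have := h (lshift n i); have := h (rshift n i).
      by rewrite /joint_family (unsplitK (inl i : 'I_n + 'I_n)).
    by rewrite /joint_family (unsplitK (inr i : 'I_n + 'I_n)).
  move=> [h1 h2] k; rewrite /joint_family; case: fintype.splitP => i ki.
    by rewrite (_ : k = lshift n i)//; exact: val_inj.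
  by rewrite (_ : k = rshift n i)//; exact: val_inj.
have /= hz := @standard_normal_box z (fun i => B (lshift n i)) nz (fun i => mB _).
have /= hxi := @standard_normal_box xi (fun i => B (rshift n i)) nxi (fun i => mB _).
by rewrite ind// zE xiE hz hxi -EFinM big_split_ord.
Qed.

End joint_gaussian.

Section orthogonal_change.
Context {R : realType} {n : nat} (O : 'M[R]_n).
Hypothesis OOT : O *m O^T = 1%:M.
Implicit Types (a v : 'cV[R]_n) (B C : 'M[R]_n).

(** A quadratic polynomial of O W is a quadratic polynomial of W with the same
    traces and lengths, by the lemmas that follow. *)
Lemma quadpoly_rotate c a B v :
  quadpoly c (O^T *m a) (O^T *m B *m O) v = quadpoly c a B (O *m v).
Proof. by rewrite /quadpoly /quadform /dotv !trmx_mul trmxK !mulmxA. Qed.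

Lemma mulmx_rotate B C :
  (O^T *m B *m O) *m (O^T *m C *m O) = O^T *m (B *m C) *m O.
Proof. by rewrite !mulmxA -(mulmxA _ O) OOT mulmx1. Qed.

Lemma mulmx_rotate_vec B a : (O^T *m B *m O) *m (O^T *m a) = O^T *m (B *m a).
Proof. by rewrite !mulmxA -(mulmxA _ O) OOT mulmx1. Qed.

Lemma mxtrace_rotate B : \tr (O^T *m B *m O) = \tr B.
Proof. by rewrite mxtrace_mulC mulmxA OOT mul1mx. Qed.

Lemma dotv_rotate a : dotv (O^T *m a) (O^T *m a) = dotv a a.
Proof. by rewrite /dotv trmx_mul trmxK !mulmxA -(mulmxA _ O) OOT mulmx1. Qed.

End orthogonal_change.

Section block_diagonal.
Context {R : realType} {n : nat}.
Implicit Types (f g h k u v : 'I_n -> R).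

(** Coordinates i and n + i are those of nu_i and zeta_i: up to a permutation
    these matrices are block diagonal with 2 x 2 blocks, and they are stable under
    products. *)
Definition blkmx f g h k : 'M[R]_(n + n) :=
  block_mx (diag_mx (\row_i f i)) (diag_mx (\row_i g i))
           (diag_mx (\row_i h i)) (diag_mx (\row_i k i)).

Definition blkcol u v : 'cV[R]_(n + n) := col_mx (\col_i u i) (\col_i v i).

Lemma blkmxM f g h k f' g' h' k' :
  blkmx f g h k *m blkmx f' g' h' k' =
  blkmx (fun i => f i * f' i + g i * h' i) (fun i => f i * g' i + g i * k' i)
        (fun i => h i * f' i + k i * h' i) (fun i => h i * g' i + k i * k' i).
Proof.
rewrite /blkmx mulmx_block !mulmx_diag -!raddfD.
by congr (block_mx (diag_mx _) (diag_mx _) (diag_mx _) (diag_mx _));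
  apply/rowP => i; rewrite !mxE.
Qed.

Lemma blkmx_col f g h k u v :
  blkmx f g h k *m blkcol u v =
  blkcol (fun i => f i * u i + g i * v i) (fun i => h i * u i + k i * v i).
Proof.
rewrite /blkmx /blkcol mul_block_col !mul_diag_mx.
by congr col_mx; apply/colP => i; rewrite !mxE.
Qed.

Lemma mxtrace_blkmx f g h k : \tr (blkmx f g h k) = \sum_i (f i + k i).
Proof.
rewrite /blkmx mxtrace_block !mxtrace_diag big_split /=.
by congr (_ + _); apply: eq_bigr => i _; rewrite mxE.
Qed.

Lemma dotv_blkcol u v u' v' :
  dotv (blkcol u v) (blkcol u' v') = \sum_i (u i * u' i + v i * v' i).
Proof.
rewrite dotvE big_split_ord /= big_split /=.
by congr (_ + _); apply: eq_bigr => i _; rewrite ?col_mxEu ?col_mxEd !mxE.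
Qed.

Lemma blkmx_tr f g k : (blkmx f g g k)^T = blkmx f g g k.
Proof. by rewrite /blkmx tr_block_mx !tr_diag_mx. Qed.

End block_diagonal.

(** * The Lyapunov condition *)

Section lyapunov.
Context {R : realType}.

(** A single t_i^2 above eta S, where S is the sum of the t_i^2, would already
    make the ratio at least eta^(1 + delta/2). Hence t_i^4 <= eta S t_i^2 for
    all i. *)
Lemma lyapunov_ratio_bound n (delta eta : R) (t : 'I_n -> R) :
  0 < delta -> 0 < eta ->
  lyapunov_ratio delta t < eta `^ (1 + delta / 2) ->
  \sum_i t i ^+ 4 <= eta * (\sum_i t i ^+ 2) ^+ 2.
Proof.
move=> d0 e0 h; set S := \sum_i t i ^+ 2.
have S0 : 0 <= S by apply: sumr_ge0 => i _; exact: sqr_ge0.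
have max_le i : t i ^+ 2 <= eta * S.
  have tS : t i ^+ 2 <= S.
    by rewrite /S (bigD1 i)//= lerDl sumr_ge0// => j _; exact: sqr_ge0.
  rewrite leNgt; apply/negP => ti.
  have Spos : 0 < S.
    by apply: lt_le_trans tS; apply: le_lt_trans ti; rewrite mulr_ge0// ltW.
  have r0 : 0 <= 1 + delta / 2 by rewrite addr_ge0// divr_ge0// ltW.
  have powE : `|t i| `^ (2 + delta) = (t i ^+ 2) `^ (1 + delta / 2).
    rewrite -(real_normK (num_real (t i))) -powR_mulrn// -powRrM; congr (_ `^ _).
    by field.
  move: h; rewrite /lyapunov_ratio ltNge => /negP; apply.
  under [X in _ / X `^ _]eq_bigr do rewrite real_normK ?num_real//.
  rewrite -/S ler_pdivlMr ?powR_gt0// -powRM ?(ltW e0)//.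
  apply: (@le_trans _ _ (`|t i| `^ (2 + delta))).
    rewrite powE; apply: ge0_ler_powR; rewrite ?nnegrE ?sqr_ge0 ?(ltW ti)//.
    by rewrite mulr_ge0 ?(ltW e0).
  by rewrite (bigD1 i)//= lerDl sumr_ge0// => j _; exact: powR_ge0.
rewrite expr2 mulrA {2}/S mulr_sumr; apply: ler_sum => i _.
rewrite (_ : t i ^+ 4 = t i ^+ 2 * t i ^+ 2); last by rewrite -exprD.
by rewrite ler_wpM2r ?sqr_ge0.
Qed.

(** The sums of squares are eventually below K = |s| + 1, so eta may be chosen
    with eta K^2 = e / 2. *)
Lemma lyapunov_sum_pow4 (delta s : R) (t : forall d, 'I_d -> R) (S : nat -> R) :
  0 < delta -> lyapunov_ratio delta (t d) @[d --> \oo] --> (0 : R) ->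
  (forall d, \sum_i t d i ^+ 2 <= S d) -> S d @[d --> \oo] --> s ->
  \sum_i t d i ^+ 4 @[d --> \oo] --> (0 : R).
Proof.
move=> d0 ht tS Ss.
apply/cvgrPdist_lt => e e0; pose K := `|s| + 1.
have K0 : 0 < K by rewrite ltr_wpDl.
pose eta := e / (2 * K ^+ 2).
have K2 : 0 < 2 * K ^+ 2 by rewrite mulr_gt0// exprn_gt0.
have eta0 : 0 < eta by rewrite divr_gt0.
have etaK : eta * K ^+ 2 < e.
  rewrite (_ : eta * K ^+ 2 = e / 2); last by rewrite /eta; field; rewrite gt_eqF.
  by rewrite ltr_pdivrMr// ltr_pMr// ltr1n.
have sK : s < K by rewrite /K ltr_pwDr// ler_norm.
near=> d.
have sq0 : 0 <= \sum_i t d i ^+ 2 by apply: sumr_ge0 => i _; exact: sqr_ge0.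
have SK : \sum_i t d i ^+ 2 <= K.
  by apply: le_trans (tS d) _; apply: ltW; near: d; exact: (cvgr_lt _ Ss).
rewrite sub0r normrN ger0_norm; last first.
  by apply: sumr_ge0 => i _; rewrite exprn_even_ge0.
apply: le_lt_trans etaK.
apply: le_trans (lyapunov_ratio_bound d0 eta0 _) _.
  by near: d; apply: (cvgr_lt _ ht); exact: powR_gt0.
by rewrite ler_wpM2l ?(ltW eta0)// lerXn2r ?nnegrE ?(ltW K0).
Unshelve. all: by end_near. Qed.

End lyapunov.

(** * Mean, variance and fourth-order terms of the log-ratio *)

Section log_ratio_quadpoly.
Context {R : realType}.

(** The squared length of B a for the block B = (t3, t5/2; t5/2, t4) and
    a = (t1, t2). *)
Lemma quartic_bound_vec (t1 t2 t3 t4 t5 : R) :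
  (t3 * t1 + t5 / 2 * t2) ^+ 2 + (t5 / 2 * t1 + t4 * t2) ^+ 2 <=
  2 * (t1 ^+ 4 + t2 ^+ 4 + t3 ^+ 4 + t4 ^+ 4 + t5 ^+ 4).
Proof.
have sq2 (x y : R) : (x + y) ^+ 2 <= 2 * (x ^+ 2 + y ^+ 2).
  by have := sqr_ge0 (x - y); lra.
have am (x y : R) : (x * y) ^+ 2 <= (x ^+ 4 + y ^+ 4) / 2.
  by have := sqr_ge0 (x ^+ 2 - y ^+ 2); lra.
have p4 (x : R) : 0 <= x ^+ 4 by rewrite exprn_even_ge0.
have := sq2 (t3 * t1) (t5 / 2 * t2); have := sq2 (t5 / 2 * t1) (t4 * t2).
have := am t3 t1; have := am t5 t2; have := am t5 t1; have := am t4 t2.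
have -> : (t5 / 2 * t2) ^+ 2 = (t5 * t2) ^+ 2 / 4 by field.
have -> : (t5 / 2 * t1) ^+ 2 = (t5 * t1) ^+ 2 / 4 by field.
have := p4 t1; have := p4 t2; have := p4 t3; have := p4 t4; have := p4 t5.
lra.
Qed.

(** The trace of B^4 for the block B = (t3, t5/2; t5/2, t4), where p, q, q', r are
    the entries of B^2. *)
Lemma quartic_bound_mx (t1 t2 t3 t4 t5 p q q' r : R) :
  p = t3 * t3 + t5 / 2 * (t5 / 2) ->
  q = t3 * (t5 / 2) + t5 / 2 * t4 ->
  q' = t5 / 2 * t3 + t4 * (t5 / 2) ->
  r = t5 / 2 * (t5 / 2) + t4 * t4 ->
  (p * p + q * q') + (q' * q + r * r) <=
  2 * (t1 ^+ 4 + t2 ^+ 4 + t3 ^+ 4 + t4 ^+ 4 + t5 ^+ 4).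
Proof.
move=> pE qE q'E rE.
have am (x y : R) : (x * y) ^+ 2 <= (x ^+ 4 + y ^+ 4) / 2.
  by have := sqr_ge0 (x ^+ 2 - y ^+ 2); lra.
have p4 (x : R) : 0 <= x ^+ 4 by rewrite exprn_even_ge0.
have h35 := am t3 t5; have h45 := am t4 t5; have h34 := am t3 t4.
have h1 : p * p = t3 ^+ 4 + (t3 * t5) ^+ 2 / 2 + t5 ^+ 4 / 16.
  by rewrite pE; field.
have h2 : r * r = t4 ^+ 4 + (t4 * t5) ^+ 2 / 2 + t5 ^+ 4 / 16.
  by rewrite rE; field.
have h3 : q * q' <= ((t3 * t5) ^+ 2 + (t4 * t5) ^+ 2) / 2.
  have -> : q * q' = (t3 * t5 + t4 * t5) ^+ 2 / 4 by rewrite qE q'E; field.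
  by have := sqr_ge0 (t3 * t5 - t4 * t5); lra.
rewrite (mulrC q') h1 h2.
have := p4 t1; have := p4 t2; have := p4 t3; have := p4 t4; have := p4 t5.
lra.
Qed.

Variables (n : nat) (A M N Q : 'M[R]_n) (b beta : 'cV[R]_n) (lam tlam G : 'I_n -> R).
Hypotheses (MTDN_posdef : posdefmx (M^T + N))
  (M_unit : M \in unitmx)
  (lam_gt0 : forall i, 0 < lam i) (tlam_gt0 : forall i, 0 < tlam i)
  (A_spectral : spectral_decomposition A Q (\row_i lam i ^+ 2))
  (M_fun : is_function_of Q (\row_i lam i ^+ 2) M)
  (N_fun : is_function_of Q (\row_i lam i ^+ 2) N)
  (MBN_eigen : forall i, (M - N) *m col i Q = tlam i ^+ 2 *: col i Q)
  (G_eigen : forall i, itermx M N *m col i Q = G i *: col i Q).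
Variables (disp : measure_display) (Omega : measurableType disp)
  (P : probability Omega R) (x xi : {RV P >-> n.-tuple R}).
Hypotheses (x_law : mvn x (invmx A *m b) (invmx A)) (xi_law : standard_normal xi)
  (x_xi_indep : independent P x xi).

Let T i := T_coef (lam i) (tlam i) (G i)
    (((col i Q)^T *m invmx A *m b) ord0 ord0
     - ((col i Q)^T *m invmx (M - N) *m beta) ord0 ord0).

Local Arguments T_coef : simpl never.

(** The expression of [mh_ratio_eigen] is a polynomial in (nu, zeta) with
    coefficient vector (T_1, T_2) and 2 x 2 blocks (T_3, T_5/2; T_5/2, T_4), and
    (nu, zeta) is the image of (z, xi) under an orthogonal matrix. *)
Lemma mh_ratio_quadpoly :
  exists (W : 'I_(n + n) -> Omega -> R) (a : 'cV[R]_(n + n)) (B : 'M[R]_(n + n)) (c : R),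
  [/\ gaussian_family P W, B^T = B,
      forall w, mh_ratio (target_pdf A b) (proposal_pdf M N beta) (cvec (x w))
          (proposal M N beta (cvec (x w)) (cvec (xi w))) =
        expR (quadpoly c a B (vec W w)),
      c + \tr B = \sum_i mu_coef (T i) /\
      dotv a a + 2 * \tr (B *m B) = \sum_i sigma2_coef (T i) &
      let S4 := \sum_i (T i 1%N ^+ 4 + T i 2%N ^+ 4 + T i 3%N ^+ 4
                        + T i 4%N ^+ 4 + T i 5%N ^+ 4) in
      dotv (B *m a) (B *m a) <= 2 * S4 /\ \tr (B *m B *m (B *m B)) <= 2 * S4].
Proof.
have [L [z [nz LLT xE]]] := x_law.
have QQT : Q *m Q^T = 1%:M by case: A_spectral.
have QTQ : Q^T *m Q = 1%:M by exact: mulmx1C.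
have l0 i : lam i ^+ 2 != 0 by rewrite expf_neq0// gt_eqF.
have AE : A = eigmx Q (fun i => lam i ^+ 2) by case: A_spectral.
have iA : invmx A = eigmx Q (fun i => (lam i ^+ 2)^-1) by rewrite AE (invmx_eigmx QQT).
have uL : L \in unitmx.
  have : invmx A \in unitmx.
    by rewrite iA unitmxE det_eigmx// unitfE prodf_seq_neq0; apply/allP => i _; rewrite invr_neq0.
  by rewrite -LLT unitmx_mul => /andP[].
pose D := diag_mx (\row_i lam i).
(* nu = U z and zeta = Q^T xi. U is orthogonal because L L^T = A^-1 =
   Q D^-2 Q^T. *)
pose U := D *m Q^T *m L.
have UUT : U *m U^T = 1%:M.
  rewrite /U !trmx_mul trmxK tr_diag_mx !mulmxA -(mulmxA _ L) LLT iA /eigmx.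
  rewrite !mulmxA -(mulmxA D) QTQ mulmx1 -(mulmxA _ Q^T) QTQ mulmx1 !mulmx_diag.
  rewrite -diag_const_mx; congr diag_mx; apply/rowP => i; rewrite !mxE.
  by field; rewrite gt_eqF.
pose O := block_mx U 0 0 Q^T.
have OOT : O *m O^T = 1%:M.
  rewrite /O tr_block_mx mulmx_block !trmx0 !mulmx0 !mul0mx !addr0 add0r UUT.
  by rewrite trmxK QTQ scalar_mx_block.
pose a0 := blkcol (fun i => T i 1%N) (fun i => T i 2%N).
pose B0 := blkmx (fun i => T i 3%N) (fun i => T i 5%N / 2) (fun i => T i 5%N / 2) (fun i => T i 4%N).
pose c := \sum_i T i 0%N.
exists (joint_family z xi), (O^T *m a0), (O^T *m B0 *m O), c; split.
- exact: gaussian_joint_family uL xE.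
- by rewrite !trmx_mul trmxK blkmx_tr mulmxA.
- move=> w.
  rewrite (mh_ratio_eigen b beta MTDN_posdef M_unit lam_gt0 tlam_gt0 A_spectral
    M_fun N_fun MBN_eigen G_eigen); congr expR.
  rewrite quadpoly_rotate vec_joint_family /O mul_block_col !mul0mx addr0 add0r.
  have -> : col_mx (U *m cvec (z w)) (Q^T *m cvec (xi w)) =
     blkcol (fun i => lam i * (Q^T *m (cvec (x w) - invmx A *m b)) i ord0)
            (fun i => (Q^T *m cvec (xi w)) i ord0).
    rewrite /blkcol; congr col_mx; apply/colP => i; rewrite [RHS]mxE//.
    rewrite xE [_ + L *m _]addrC addrK /U /D -!mulmxA mul_diag_mx.
    by rewrite mxE mxE.
  rewrite /quadpoly quadformE blkmx_col !dotv_blkcol /c -!big_split /=.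
  by apply: eq_bigr => i _; rewrite -/(T i); move: (T i) => t; field.
- rewrite (mulmx_rotate OOT) !(mxtrace_rotate OOT) (dotv_rotate OOT).
  rewrite blkmxM !mxtrace_blkmx dotv_blkcol /c mulr_sumr -!big_split /=.
  by split; apply: eq_bigr => i _; rewrite /mu_coef /sigma2_coef; field.
- rewrite (mulmx_rotate_vec OOT) (dotv_rotate OOT) !(mulmx_rotate OOT) (mxtrace_rotate OOT).
  rewrite blkmx_col dotv_blkcol !blkmxM mxtrace_blkmx; cbv zeta; rewrite mulr_sumr.
  split; apply: ler_sum => i _.
    by rewrite -!expr2; exact: quartic_bound_vec.
  exact: quartic_bound_mx erefl erefl erefl erefl.
Qed.

End log_ratio_quadpoly.

(** * Asymptotic normality and the expected acceptance rate *)

(** Chooses the normal vectors and polynomials of all dimensions at once. *)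
Lemma dependent_choice_nat (A : nat -> Type) (Q : forall d, A d -> Prop) :
  (forall d, exists x, Q d x) -> exists f : forall d, A d, forall d, Q d (f d).
Proof.
by move=> h; exists (fun d => sval (cid (h d))) => d; exact: (svalP (cid (h d))).
Qed.

Lemma mxtrace_sqr_ge0 {R : realType} n (S : 'M[R]_n) : S^T = S -> 0 <= \tr (S *m S).
Proof.
move=> sS; apply: sumr_ge0 => i _; rewrite mxE; apply: sumr_ge0 => j _.
by rewrite -{2}sS mxE -expr2 sqr_ge0.
Qed.

Theorem theorem3p4 (R : realType)
    (* data in each dimension d *)
    (A M N Q : forall d : nat, 'M[R]_d) (b beta : forall d : nat, 'cV[R]_d)
    (lam tlam G : forall d : nat, 'I_d -> R)
    (A_posdef : forall d, posdefmx (A d))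
    (MBN_posdef : forall d, posdefmx (M d - N d))
    (MTDN_posdef : forall d, posdefmx ((M d)^T + N d))
    (M_unit : forall d, M d \in unitmx)
    (lam_gt0 : forall d i, 0 < lam d i)
    (tlam_gt0 : forall d i, 0 < tlam d i)
    (A_spectral : forall d,
      spectral_decomposition (A d) (Q d) (\row_i lam d i ^+ 2))
    (M_fun : forall d, is_function_of (Q d) (\row_i lam d i ^+ 2) (M d))
    (N_fun : forall d, is_function_of (Q d) (\row_i lam d i ^+ 2) (N d))
    (MBN_eigen : forall d i,
      (M d - N d) *m col i (Q d) = tlam d i ^+ 2 *: col i (Q d))
    (G_eigen : forall d i,
      itermx (M d) (N d) *m col i (Q d) = G d i *: col i (Q d))
    (* the current state x, in equilibrium, and the noise xi *)
    (disp : nat -> measure_display) (Omega : forall d, measurableType (disp d))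
    (P : forall d, probability (Omega d) R)
    (x xi : forall d, {RV (P d) >-> d.-tuple R})
    (x_law : forall d, mvn (x d) (invmx (A d) *m b d) (invmx (A d)))
    (xi_law : forall d, standard_normal (xi d))
    (x_xi_indep : forall d, independent (P d) (x d) (xi d))
    (mu sigma : R) :
  let m d i := ((col i (Q d))^T *m invmx (A d) *m b d) ord0 ord0 in
  let tm d i := ((col i (Q d))^T *m invmx (M d - N d) *m beta d) ord0 ord0 in
  let T d i := T_coef (lam d i) (tlam d i) (G d i) (m d i - tm d i) in
  let X d w := cvec (x d w) in
  let Y d w := proposal (M d) (N d) (beta d) (X d w) (cvec (xi d w)) in
  let p d := target_pdf (A d) (b d) in
  let q d := proposal_pdf (M d) (N d) (beta d) in
  let Z d w := ln (mh_ratio (p d) (q d) (X d w) (Y d w)) in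
  let alpha d w := acceptance (p d) (q d) (X d w) (Y d w) in
  (exists2 delta : R, 0 < delta &
     forall j : nat, (1 <= j <= 5)%N ->
       lyapunov_ratio delta (fun i => T d i j) @[d --> \oo] --> 0) ->
  \sum_(i < d) mu_coef (T d i) @[d --> \oo] --> mu ->
  \sum_(i < d) sigma2_coef (T d i) @[d --> \oo] --> sigma ^+ 2 ->
  0 < sigma ->
  cvg_in_distribution P Z (normal_prob mu sigma) /\
  ('E_(P d)[alpha d])%E @[d --> \oo] -->
    (Phi (mu / sigma)
     + expR (mu + sigma ^+ 2 / 2) * Phi (- sigma - mu / sigma))%:E.
Proof.
move=> m tm T X Y p q Z alpha [delta d0 lyap] muc sigc s0.
have rep d := mh_ratio_quadpoly (beta d) (MTDN_posdef d) (M_unit d)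
  (lam_gt0 d) (tlam_gt0 d) (A_spectral d) (M_fun d) (N_fun d) (MBN_eigen d)
  (G_eigen d) (x_law d) (xi_law d) (x_xi_indep d).
have [W {}rep] := dependent_choice_nat rep.
have [a {}rep] := dependent_choice_nat rep.
have [B {}rep] := dependent_choice_nat rep.
have [c {}rep] := dependent_choice_nat rep.
have gW d : gaussian_family (P d) (W d) by case: (rep d).
have sB d : (B d)^T = B d by case: (rep d).
have ratioE d w : mh_ratio (p d) (q d) (X d w) (Y d w) =
    expR (quadpoly (c d) (a d) (B d) (vec (W d) w)).
  by case: (rep d) => _ _ h _ _; exact: h.
have meanE d : c d + \tr (B d) = \sum_(i < d) mu_coef (T d i).
  by case: (rep d) => _ _ _ [].
have varE d : dotv (a d) (a d) + 2 * \tr (B d *m B d) = \sum_(i < d) sigma2_coef (T d i).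
  by case: (rep d) => _ _ _ [].
pose S4 d := \sum_(i < d) (T d i 1%N ^+ 4 + T d i 2%N ^+ 4 + T d i 3%N ^+ 4
                           + T d i 4%N ^+ 4 + T d i 5%N ^+ 4).
have vecS4 d : dotv (B d *m a d) (B d *m a d) <= 2 * S4 d.
  by case: (rep d) => _ _ _ _ [].
have trS4 d : \tr (B d *m B d *m (B d *m B d)) <= 2 * S4 d.
  by case: (rep d) => _ _ _ _ [].
(* Each T_ji^2 is at most sigma_i^2, so the sums of squares stay bounded. *)
have T4 (j : nat) : (1 <= j <= 5)%N -> \sum_(i < d) T d i j ^+ 4 @[d --> \oo] --> (0 : R).
  move=> j15; apply: (lyapunov_sum_pow4 d0 (lyap j j15) _ sigc) => d.
  apply: ler_sum => i _; rewrite /sigma2_coef.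
  have h k := sqr_ge0 (T d i k); have := h 1%N; have := h 2%N; have := h 3%N.
  have := h 4%N; have := h 5%N.
  by case: j j15 => [|[|[|[|[|[|j]]]]]] // _; lra.
have S4c : 2 * S4 d @[d --> \oo] --> (0 : R).
  have -> : (fun d => 2 * S4 d) = (fun d => 2 * (\sum_(i < d) T d i 1%N ^+ 4
      + \sum_(i < d) T d i 2%N ^+ 4 + \sum_(i < d) T d i 3%N ^+ 4
      + \sum_(i < d) T d i 4%N ^+ 4 + \sum_(i < d) T d i 5%N ^+ 4)).
    by apply/funext => d; rewrite /S4 !big_split.
  rewrite -[X in _ --> X](_ : 2 * (0 + 0 + 0 + 0 + 0) = 0 :> R); last by ring.
  by apply: cvgMr; do 4 (apply: cvgD; last exact: T4); exact: T4.
have vecc : dotv (B d *m a d) (B d *m a d) @[d --> \oo] --> (0 : R).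
  apply: (squeeze_cvgr _ (cvg_cst 0) S4c); apply: nearW => d.
  by rewrite dotv_ge0 vecS4.
have trc : \tr (B d *m B d *m (B d *m B d)) @[d --> \oo] --> (0 : R).
  apply: (squeeze_cvgr _ (cvg_cst 0) S4c); apply: nearW => d.
  by rewrite mxtrace_sqr_ge0 ?trS4// trmx_mul sB.
have meanc : c d + \tr (B d) @[d --> \oo] --> mu.
  by rewrite (funext meanE).
have varc : dotv (a d) (a d) + 2 * \tr (B d *m B d) @[d --> \oo] --> sigma ^+ 2.
  by rewrite (funext varE).
have lim (h : R -> R) : continuous h -> (forall u, `|h u| <= 1) ->
    \int[P d]_w h (quadpoly (c d) (a d) (B d) (vec (W d) w)) @[d --> \oo] -->
    \int[normal_prob (0 : R) 1]_u h (mu + sigma * u).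
  by move=> ch h1; apply: quadpoly_cvg_normal h1.
have mQ d : measurable_fun setT (fun w => quadpoly (c d) (a d) (B d) (vec (W d) w)).
  apply: quadpoly_measurable => k; under eq_fun do rewrite mxE.
  exact: (gW d).1.
have ZE d w : Z d w = quadpoly (c d) (a d) (B d) (vec (W d) w).
  by rewrite /Z ratioE expRK.
split.
  apply: cvg_in_distribution_normal => //.
    by move=> d; rewrite (funext (ZE d)).
  move=> h ch h1; apply: eq_cvgn (lim h ch h1) => d.
  by apply: eq_Rintegral => w _; rewrite ZE.
pose g (u : R) := Num.min 1 (expR u).
have g1 u : `|g u| <= 1.
  by rewrite ger0_norm ?ge_min ?lexx// le_min ler01 expR_ge0.
have cg : continuous g.
  move=> u; apply: (@continuous_min R R (fun=> 1) expR u); first exact: cvg_cst.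
  exact: continuous_expR.
rewrite -std_normal_integral_min1_expR//.
have EE d : ('E_(P d)[alpha d])%E =
    (\int[P d]_w g (quadpoly (c d) (a d) (B d) (vec (W d) w)))%:E.
  rewrite unlock /Rintegral fineK; last first.
    apply: integrable_fin_num => //.
    apply: (@le_integrable _ _ _ (P d) _ measurableT _ (EFin \o cst 1)).
    - apply/measurable_EFinP; apply: (measurableT_comp _ (mQ d)).
      exact: continuous_measurable_fun.
    - by move=> w _; rewrite lee_fin normr1.
    - exact: finite_measure_integrable_cst.
  by apply: eq_integral => w _; rewrite /alpha /acceptance ratioE.
rewrite (funext EE); apply: cvg_EFin; first exact: nearW.
exact: lim.
Qed.
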